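(* Let the $2\times2$ twist matrix $K$ be invertible and not proportional to the identity, with eigenvalues $\mathsf k_1,\mathsf k_2$. Let the inhomogeneities satisfy $\xi_i\neq\xi_j\bmod\eta$ for $i\ne j$, and let $\langle S|\in\mathcal H^*$ and the inhomogeneities be such that the co-vectors $$\langle h_1,\dots,h_N|=\langle S|\prod_{n=1}^N\frac{\mathsf k_2^{h_n-2s_n}\,\mathsf T^{(K|2s_n-h_n)}(\xi_n^{(2s_n)})}{\prod_{k=0}^{2s_n-h_n-1}d(\xi_n^{(2s_n-k)})},\qquad h_n\in\{0,\dots,2s_n\},$$ form a basis of $\mathcal H^*$, the SoV basis (which holds for almost any choice of them). Then the transfer matrix has the following separate action on the SoV basis co-vectors: for every $n\in\{1,\dots,N\}$ and every $(h_1,\dots,h_N)$ with $h_i\in\{0,\dots,2s_i\}$, $$\langle h_1,\dots,h_N|\mathsf T^{(K)}(\xi_n^{(h_n)})=\mathsf k_1a(\xi_n^{(h_n)})\langle h_1,\dots,h_n+1,\dots,h_N|+\mathsf k_2d(\xi_n^{(h_n)})\langle h_1,\dots,h_n-1,\dots,h_N|,$$ where co-vectors with an index out of range are understood as zero (their coefficients vanish since $a(\xi_n^{(2s_n)})=0=d(\xi_n^{(0)})$).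
   Context: Setting. Let $\eta\in\mathbb{C}\setminus\{0\}$, $N\ge1$, and let $s_1,\dots,s_N$ be spins with $2s_n\in\mathbb{Z}_{>0}$. Let $V_n=\mathbb{C}^{2s_n+1}$ and $\mathcal H=\bigotimes_{n=1}^N V_n$. On $V_n$ let $S_n^z=\mathrm{diag}(s_n,s_n-1,\dots,-s_n)$, let $S_n^+$ be the matrix with only nonzero entries $(S_n^+)_{j,j+1}=\sqrt{j(2s_n+1-j)}$, $1\le j\le 2s_n$, and let $S_n^-=(S_n^+)^t$. With auxiliary space $V_0=\mathbb{C}^2$, the Lax operator is $$\mathsf L_{0n}(\lambda)=\begin{pmatrix}\lambda+\eta(\tfrac12+S_n^z)&\eta S_n^-\\ \eta S_n^+&\lambda+\eta(\tfrac12-S_n^z)\end{pmatrix}_{[0]}.$$ For a $2\times2$ twist matrix $K$ and inhomogeneities $\xi_1,\dots,\xi_N\in\mathbb{C}$, the monodromy matrix is $\mathsf M_0(\lambda)=K_0\mathsf L_{0N}(\lambda-\xi_N)\cdots\mathsf L_{01}(\lambda-\xi_1)$ and the transfer matrix is $\mathsf T^{(K)}(\lambda)=\mathsf T^{(K|1)}(\lambda)=\mathrm{tr}_0\mathsf M_0(\lambda)$. Fused transfer matrices. For $l\ge1$, let $P^+_{1\dots l}$ be the projector onto symmetric tensors in $(\mathbb{C}^2)^{\otimes l}$, with image $V^+_{1\dots l}$. Set $\mathsf T^{(K|l)}(\lambda)=\mathrm{tr}_{V^+_{1\dots l}}\big[P^+_{1\dots l}\mathsf M_1(\lambda+(l-1)\eta)\cdots\mathsf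 M_{l-1}(\lambda+\eta)\mathsf M_l(\lambda)P^+_{1\dots l}\big]$, $\mathsf T^{(K|0)}(\lambda)=1$, and $\mathsf T^{(K|l)}=0$ for $l<0$. All these operators commute with each other and satisfy the known fusion relations $\mathsf T^{(K|l+1)}(\lambda)=\mathsf T^{(K)}(\lambda+l\eta)\mathsf T^{(K|l)}(\lambda)-\mathsf k_1\mathsf k_2a(\lambda+l\eta)d(\lambda+(l-1)\eta)\mathsf T^{(K|l-1)}(\lambda)$. Notation. $\xi_n^{(k)}=\xi_n-\tfrac\eta2+(s_n-k)\eta$, $a(\lambda)=\prod_{n=1}^N(\lambda-\xi_n^{(2s_n)})$, $d(\lambda)=\prod_{n=1}^N(\lambda-\xi_n^{(0)})$. Co-vectors are acted upon from the right. ''Almost any'' means outside the zero set of some nonzero polynomial. *)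

(* Defs.v *)
From mathcomp Require Import all_boot all_order all_algebra all_fingroup.
From mathcomp Require Import reals complex mpoly.

Set Implicit Arguments.
Unset Strict Implicit.
Unset Printing Implicit Defensive.

Import Order.TTheory GRing.Theory Num.Theory.

Local Open Scope ring_scope.

(* The tensor product of the spaces of dimensions d 0, ..., d (p - 1) is
   coordinatised by multi-indices; an operator on it is a square matrix
   over 'I_#|{: tidx d}|, identified with tidx d by mindex. *)
Notation tidx d := {dffun forall n, 'I_(d n)}.

Definition tdim (p : nat) (d : 'I_p -> nat) : nat := #|{: tidx d}|.

Definition mindex (p : nat) (d : 'I_p -> nat) (i : 'I_(tdim d)) : tidx d :=
  enum_val i.

(* 1 (x) ... (x) A (x) ... (x) 1, with A acting on the n-th factor.  The
   coefficients may be noncommutative, e.g. operators on another space. *)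
Definition on_site (R : pzRingType) (p : nat) (d : 'I_p -> nat) (n : 'I_p)
    (A : 'M[R]_(d n)) : 'M[R]_(tdim d) :=
  \matrix_(i, j)
    if [forall m, (m != n) ==> (mindex i m == mindex j m)]
    then A (mindex i n) (mindex j n) else 0.

Section SpinChain.

Variables (C : numClosedFieldType) (eta : C).

(* A spin s is represented by the natural number e = 2s.  Rows and columns
   are numbered from 0. *)

Definition half_spin (e : nat) : C := e%:R / 2%:R.

Definition spin_z (e : nat) : 'M[C]_e.+1 :=
  \matrix_(i, j) if i == j then half_spin e - i%:R else 0.

Definition spin_plus (e : nat) : 'M[C]_e.+1 :=
  \matrix_(i, j) if j == i.+1 :> nat then sqrtC (i.+1 * (e - i))%:R else 0.

Definition spin_minus (e : nat) : 'M[C]_e.+1 := (spin_plus e)^T.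

Variables (N : nat) (e : 'I_N -> nat).

Definition site_dim (n : 'I_N) : nat := (e n).+1.

Definition hdim : nat := tdim site_dim.

Definition endH : pzRingType := 'M[C]_hdim.

(* Operators on V_0 (x) H, with V_0 = C^2, are 2 x 2 matrices over endH, and
   then tr_0 is the matrix trace with values in endH. *)
Definition Lax (n : 'I_N) (lambda : C) : 'M[endH]_2 :=
  let Sz := spin_z (e n) in
  \matrix_(i, j)
    if i == 0 then
      if j == 0
      then on_site (d := site_dim) ((lambda + eta / 2%:R)%:M + eta *: Sz)
      else on_site (d := site_dim) (eta *: spin_minus (e n))
    else
      if j == 0
      then on_site (d := site_dim) (eta *: spin_plus (e n))
      else on_site (d := site_dim) ((lambda + eta / 2%:R)%:M - eta *: Sz).

Variable xi : 'I_N -> C.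

(* xi_n^{(k)} *)
Definition xi_shift (n : 'I_N) (k : nat) : C :=
  xi n - eta / 2%:R + (half_spin (e n) - k%:R) * eta.

Definition a_fun (lambda : C) : C :=
  \prod_(n < N) (lambda - xi_shift n (e n)).

Definition d_fun (lambda : C) : C :=
  \prod_(n < N) (lambda - xi_shift n 0).

Variable K : 'M[C]_2.

(* Products over 'I_p are taken in increasing order of the index; rev_ord puts
   the last site on the left. *)
Definition monodromy (lambda : C) : 'M[endH]_2 :=
  map_mx (fun c : C => c%:M : endH) K *
  \prod_(n < N) Lax (rev_ord n) (lambda - xi (rev_ord n)).

Definition transfer (lambda : C) : endH := \tr (monodromy lambda).

Definition aux_dim (l : nat) (_ : 'I_l) : nat := 2.

Definition perm_op (l : nat) (s : 'S_l) : 'M[C]_(tdim (@aux_dim l)) :=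
  \matrix_(i, j)
    [forall k, mindex i (s k) == mindex j k :> 'I_2]%:R.

(* The projector onto symmetric tensors of (C^2)^{(x) l}. *)
Definition sym_proj (l : nat) : 'M[C]_(tdim (@aux_dim l)) :=
  (l`!%:R)^-1 *: \sum_(s : 'S_l) perm_op s.

(* The trace over the image of the projector P of P X P is its trace over the
   whole auxiliary space, as P X P maps into that image and vanishes on the
   kernel of P.  For k : 'I_l, the value of rev_ord k is l - 1 - k. *)
Definition fused_transfer (l : nat) (lambda : C) : endH :=
  if l is 0 then 1 else
  let P := map_mx (fun c : C => c%:M : endH) (sym_proj l) in
  \tr (P *
       (\prod_(k < l) on_site (d := @aux_dim l) (n := k)
                        (monodromy (lambda + (rev_ord k)%:R * eta))) *
       P).

(* Co-vectors are row vectors, acted upon from the right by matrices. *)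
Variables (k2 : C) (S : 'rV[C]_hdim).

Definition sov_covector (h : tidx site_dim) : 'rV[C]_hdim :=
  S *m \prod_(n < N)
    ((k2 ^- (e n - h n) /
        \prod_(k < e n - h n) d_fun (xi_shift n (e n - k)))
     *: fused_transfer (e n - h n) (xi_shift n (e n))).

(* The same, extended by zero to indices out of range. *)
Definition sov_covector_ext (h : 'I_N -> int) : 'rV[C]_hdim :=
  if [pick g : tidx site_dim | [forall n, (g n)%:Z == h n]] is Some g
  then sov_covector g else 0.

Definition sov_basis : Prop :=
  basis_of {:'rV[C]_hdim} [seq sov_covector h | h : tidx site_dim].

Definition distinct_mod_eta : Prop :=
  forall i j : 'I_N, i != j -> forall z : int, xi i - xi j != z%:~R * eta.

End SpinChain.

(* Main.v *)
Require Import Defs.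
From mathcomp Require Import all_boot all_order all_algebra all_fingroup.
From mathcomp Require Import reals complex mpoly ring zify.

Set Implicit Arguments.
Unset Strict Implicit.
Unset Printing Implicit Defensive.

Import Order.TTheory GRing.Theory Num.Theory.

Local Open Scope ring_scope.

(* At spectral parameters differing by eta the exchange relation says that the
   entries of the monodromy matrix satisfy t_ij u_kl + t_kj u_il =
   t_il u_kj + t_kl u_ij.  A column-symmetrised entry of a fused product is
   therefore symmetric in its column indices, and peeling off the first factor
   gives the fusion relations; the quantum determinant multiplies over the sites.
   The fused Lax operator of length 2s + 1 vanishes on a spin s at the parameter
   of xi^{(2s)}: its entries with row indices 1...1 are products of operators that
   push the flag of the weight basis down by one step each, and commuting with S^+
   produces all other rows.  Hence T^{(2s_n+1)}(xi_n^{(2s_n)}) = 0, and the fusion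
   relations at xi_n^{(2s_n)} are exactly the separate action.

   For the basis property it suffices to find one pair (xi, S) for which the
   covectors are independent.  Put xi_n = n / u.  After clearing powers of u all
   quantities are polynomial in u, and at u = 0 the sites decouple: the fused
   transfer matrix number l at xi_n^{(2s_n)} becomes a polynomial of degree l in
   the element of sl_2 given by the traceless part of K, acting on site n.  This
   element is nonzero, hence cyclic on the irreducible module V_n, and a product
   covector does the job. *)

(** * Fusion *)

(** The coefficients of the auxiliary 2 x 2 matrices are operators on the chain and do not commute,
    so neither cyclicity of the trace nor the usual determinant is at hand. Fused operators are
    therefore handled through the sums [fused_entry], in which rows are grouped by their number r of
    ones. As columns matter only through their number q of ones, the pairs (r, q) index a matrix on
    the l-th symmetric power, and its diagonal sum is the fused transfer matrix; the factorials of
    the projector are cancelled by absence of torsion.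

    The action also needs nonzero values of d in the denominators. These come from the basis
    hypothesis itself: with the convention 0^-1 = 0, a zero denominator would make a basis covector
    vanish.

    Spreading the inhomogeneities isolates a site because near xi_n the Lax operators of the other
    sites are dominated by their scalar part. The sites decouple only at u = 0, where xi is
    undefined; a polynomial that is nonzero at 0 is also nonzero at some u different from 0. *)

Lemma sum_two (V : nmodType) (F : 'I_2 -> V) : \sum_i F i = F 0 + F 1.
Proof. by rewrite big_ord_recl big_ord1; congr (_ + F _); apply/val_inj. Qed.

Lemma ord2_cases (i : 'I_2) : i = 0 \/ i = 1.
Proof.
case: i => [[|[|i]] hi] //; [left | right]; exact/val_inj.
Qed.

Section Fusion.

Variable A : pzRingType.

Implicit Types (t u : 'M[A]_2) (M : nat -> 'M[A]_2).

(** The exchange relation at distance eta, where the R-matrix is proportional to 1 plus the flip: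
    symmetrising the rows i, k makes the product symmetric in the columns j, l. *)
Definition manin t u : Prop := forall i k j l,
  t i j * u k l + t k j * u i l = t i l * u k j + t k l * u i j.

(** The quantum determinant, for t = M(lambda + eta) and u = M(lambda); the order of the factors
    matters. *)
Definition qdet t u : A := t 1 1 * u 0 0 - t 1 0 * u 0 1.

Definition pred_val (f : nat -> A) (r : nat) : A :=
  if r is r'.+1 then f r' else 0.

(* With [M k] standing for M(lambda + k eta), this is the sum, over the
   multi-indices i with r entries equal to 1, of the products
   M(lambda + (l - 1) eta)_{i_1 j_1} ... M(lambda)_{i_l j_l}. *)
Fixpoint fused_entry M j : nat -> A :=
  if j is x :: j' then
    fun r => M (size j') 0 x * fused_entry M j' r
             + M (size j') 1 x * pred_val (fused_entry M j') r
  else fun r => (r == 0%N)%:R.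

(** The sorted word represents all column words of length l with q ones, see
    [fused_entry_ordered]. *)
Definition ordered_entry M (l q : nat) : nat -> A :=
  fused_entry M (nseq (l - q) 0 ++ nseq q 1).

Definition fused_trace M (l : nat) : A :=
  \sum_(r < l.+1) ordered_entry M l r r.

Lemma fused_entry_large M j r : (size j < r)%N -> fused_entry M j r = 0.
Proof.
elim: j r => [|x j IHj] [|r] //= hr.
by rewrite !IHj ?(ltnW hr) // !mulr0 addr0.
Qed.

Hypothesis two_reg : forall a : A, a *+ 2 = 0 -> a = 0.

(** The case k = i of the relation is twice this equality. *)
Lemma manin_row t u (i j l : 'I_2) : manin t u -> t i j * u i l = t i l * u i j.
Proof.
move=> htu; apply/eqP; rewrite -subr_eq0; apply/eqP; apply: two_reg.
rewrite mulrnBl !mulr2n; apply/eqP; rewrite subr_eq0; apply/eqP.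
exact: htu.
Qed.

Section Ordering.

Variable M : nat -> 'M[A]_2.
Hypothesis Mmanin : forall k, manin (M k.+1) (M k).

Lemma fused_entry_swap x y j r :
  fused_entry M [:: x, y & j] r = fused_entry M [:: y, x & j] r.
Proof.
case: r => [|r] /=.
  by rewrite !mulr0 !addr0 !mulrA (manin_row _ _ _ (Mmanin _)).
set k := size j; set f := fused_entry M j.
(* Grouped by the rows of the first two factors (00, mixed, 11), each coefficient is symmetric in
   the two columns: the outer ones by [manin_row], the middle one by the relation itself. *)
suff E a b c : M k.+1 0 a * (M k 0 b * f r.+1 + M k 1 b * f r)
             + M k.+1 1 a * (M k 0 b * f r + M k 1 b * c)
           = M k.+1 0 a * M k 0 b * f r.+1
             + (M k.+1 0 a * M k 1 b + M k.+1 1 a * M k 0 b) * f r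
             + M k.+1 1 a * M k 1 b * c.
  by rewrite !E (manin_row 0 _ _ (Mmanin _)) Mmanin (manin_row 1 _ _ (Mmanin _)).
by rewrite !mulrDr !mulrDl !mulrA !addrA.
Qed.

Lemma fused_entry_cons x j1 j2 : size j1 = size j2 ->
  fused_entry M j1 =1 fused_entry M j2 ->
  fused_entry M (x :: j1) =1 fused_entry M (x :: j2).
Proof.
by move=> hs hj r; rewrite /= hs hj; congr (_ + _ * _); case: r => /=.
Qed.

Lemma fused_entry_one n q :
  fused_entry M (1 :: nseq n 0 ++ nseq q 1)
  =1 fused_entry M (nseq n 0 ++ nseq q.+1 1).
Proof.
elim: n => [|n IHn] r; first by [].
transitivity (fused_entry M [:: 0, 1 & nseq n 0 ++ nseq q 1] r).
  exact: fused_entry_swap.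
apply: (@fused_entry_cons 0 _ (nseq n 0 ++ nseq q.+1 1)) => //.
by rewrite [LHS]/= !size_cat !size_nseq addnS.
Qed.

Lemma fused_entry_ordered j r :
  fused_entry M j r = ordered_entry M (size j) (count_mem 1%R j) r.
Proof.
rewrite /ordered_entry; elim: j r => [|x j IHj] r; first by [].
have hc : (count_mem 1%R j <= size j)%N := count_size _ _.
pose w : seq 'I_2 := nseq (size j - count_mem 1%R j) 0 ++ nseq (count_mem 1%R j) 1.
transitivity (fused_entry M (x :: w) r).
  by apply: fused_entry_cons => //; rewrite size_cat !size_nseq subnK.
case: (ord2_cases x) => ->; last by rewrite fused_entry_one /= add1n subSS.
by rewrite -[count_mem _ _]/(count_mem 1%R j) -[size (_ :: _)]/(size j).+1 subSn.
Qed.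

Lemma ordered_entry0 l q r : (q <= l)%N ->
  ordered_entry M l.+1 q r = M l 0 0 * ordered_entry M l q r
    + M l 1 0 * pred_val (ordered_entry M l q) r.
Proof.
move=> hq; rewrite /ordered_entry subSn //= size_cat !size_nseq.
by rewrite subnK.
Qed.

Lemma ordered_entry1 l q r : (q <= l)%N ->
  ordered_entry M l.+1 q.+1 r = M l 0 1 * ordered_entry M l q r
    + M l 1 1 * pred_val (ordered_entry M l q) r.
Proof.
move=> hq; rewrite /ordered_entry subSS -fused_entry_one /=.
by rewrite size_cat !size_nseq subnK.
Qed.

Lemma ordered_entry_large l q r : (q <= l)%N -> (l < r)%N ->
  ordered_entry M l q r = 0.
Proof.
by move=> hq hr; apply: fused_entry_large; rewrite size_cat !size_nseq subnK.
Qed.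

(** Peeling off one factor couples the trace to this off-diagonal sum only, so the two satisfy a
    closed recursion; eliminating [subtrace] gives the fusion relation. *)
Let subtrace l : A := \sum_(r < l) ordered_entry M l r.+1 r.

Let diag_sum l : \sum_(r < l.+1) ordered_entry M l.+1 r r
  = M l 0 0 * fused_trace M l + M l 1 0 * subtrace l.
Proof.
under eq_bigr => r _ do rewrite ordered_entry0 -1?ltnS //.
rewrite big_split -!mulr_sumr; congr (_ + _ * _).
by rewrite big_ord_recl /= add0r.
Qed.

Let subtrace_sum l :
  subtrace l.+1 = M l 0 1 * fused_trace M l + M l 1 1 * subtrace l.
Proof.
rewrite /subtrace.
under eq_bigr => r _ do rewrite ordered_entry1 -1?ltnS //.
rewrite big_split -!mulr_sumr; congr (_ + _ * _).
by rewrite big_ord_recl /= add0r.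
Qed.

Let trace_step l : fused_trace M l.+1
  = M l 0 0 * fused_trace M l + M l 1 0 * subtrace l
    + M l 1 1 * ordered_entry M l l l.
Proof.
rewrite {1}/fused_trace big_ord_recr /= diag_sum ordered_entry1 //=.
by rewrite (ordered_entry_large (leqnn l)) // mulr0 add0r.
Qed.

Lemma fused_trace0 : fused_trace M 0 = 1.
Proof. by rewrite /fused_trace big_ord1. Qed.

Lemma fused_trace1 : fused_trace M 1 = \tr (M 0).
Proof.
rewrite trace_step fused_trace0 /subtrace big_ord0 /= /mxtrace sum_two.
by rewrite /ordered_entry /= !mulr0 !mulr1 addr0.
Qed.

(** With t = M(l + 1) and u = M(l), the off-diagonal sum appears with coefficient t_11 u_10 - t_10
    u_11, which is zero by [manin_row]; what remains in front of the trace number l is the quantum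
    determinant. *)
Lemma fusion_recursion l : fused_trace M l.+2
  = \tr (M l.+1) * fused_trace M l.+1
    - qdet (M l.+1) (M l) * fused_trace M l.
Proof.
rewrite /mxtrace sum_two mulrDl trace_step subtrace_sum -!addrA.
congr (_ + _); rewrite {2}/fused_trace big_ord_recr /= diag_sum.
rewrite /qdet mulrBl !mulrDr !mulrA (manin_row 1 0 1 (Mmanin l)) opprB.
set a := M l.+1 1 1; set b := M l.+1 1 0.
rewrite -!mulrA; set t := fused_trace M l; set s := subtrace l.
rewrite [RHS]addrC !addrA addrNK.
by rewrite [in RHS]addrC -!addrA [RHS]addrCA; congr (_ + _); rewrite addrC.
Qed.

End Ordering.

Lemma fused_trace_null M l :
  (forall j, size j = l -> forall r, fused_entry M j r = 0) ->
  fused_trace M l = 0.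
Proof.
move=> h; apply: big1 => r _; apply: h.
by rewrite size_cat !size_nseq subnK // -ltnS.
Qed.

End Fusion.

Lemma sum_tuple_cons (V : nmodType) (T : finType) (l : nat)
    (F : l.+1.-tuple T -> V) :
  \sum_t F t = \sum_x \sum_(t : l.-tuple T) F [tuple of x :: t].
Proof.
rewrite pair_big /=; apply: (reindex (fun p : T * l.-tuple T => [tuple of p.1 :: p.2])).
exists (fun t => (thead t, [tuple of behead t])) => [[x t] _ | t _] /=.
  by congr (_, _); apply/val_inj.
by rewrite [in RHS](tuple_eta t); apply/val_inj.
Qed.

(** * The trace over symmetric tensors as a sum over words *)

Section Words.

Variables (A : pzRingType) (M : nat -> 'M[A]_2).

Fixpoint word (i j : seq 'I_2) : A :=
  match i, j with
  | x :: i', y :: j' => M (size j') x y * word i' j'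
  | _, _ => 1
  end.

Lemma word_codom l (f g : 'I_l -> 'I_2) :
  \prod_(k < l) M (rev_ord k) (f k) (g k) = word (codom f) (codom g).
Proof.
elim: l f g => [|l IHl] f g.
  by rewrite big_ord0 /codom /image_mem enum_ord0.
rewrite big_ord_recl /codom /image_mem enum_ordSl /= subSS subn0.
rewrite !size_map -enumT size_enum_ord -(map_comp f) -(map_comp g); congr (_ * _).
rewrite -[RHS]/(word (codom (f \o lift ord0)) (codom (g \o lift ord0))) -IHl.
by apply: eq_bigr => k _ /=; rewrite /bump /= add1n subSS.
Qed.

Lemma fused_entry_sum l (j : l.-tuple 'I_2) r :
  fused_entry M j r = \sum_(i : l.-tuple 'I_2 | count_mem 1%R i == r) word i j.
Proof.
rewrite big_mkcond; elim: l j r => [|l IHl] j r.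
  rewrite (tuple0 j) /= (big_pred1 ([tuple] : 0.-tuple 'I_2)) /=.
    by case: r.
  by move=> i; apply/esym/eqP/tuple0.
case/tupleP: j => y j; rewrite sum_tuple_cons sum_two /=.
have hs : size j = l := size_tuple j.
rewrite hs; congr (_ + _).
  rewrite IHl mulr_sumr; apply: eq_bigr => i _ /=.
  by rewrite add0n; case: ifP => _; rewrite ?mulr0.
case: r => [|r] /=.
  by rewrite mulr0 big1 // => i _; rewrite add1n.
rewrite IHl mulr_sumr; apply: eq_bigr => i _ /=.
by rewrite add1n eqSS; case: ifP => _; rewrite ?mulr0.
Qed.

Definition permute l (s : 'S_l) (i : l.-tuple 'I_2) : l.-tuple 'I_2 :=
  [tuple tnth i (s k) | k < l].

Lemma permuteM l (s t : 'S_l) i : permute s (permute t i) = permute (s * t)%g i.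
Proof. by apply: eq_from_tnth => k; rewrite !tnth_mktuple permM. Qed.

Lemma permute1 l (i : l.-tuple 'I_2) : permute 1%g i = i.
Proof. by apply: eq_from_tnth => k; rewrite tnth_mktuple perm1. Qed.

Lemma perm_eq_count (i j : seq 'I_2) : size i = size j ->
  count_mem 1%R i = count_mem 1%R j -> perm_eq i j.
Proof.
move=> hs hc; apply/allP => x _ /=; case: (ord2_cases x) => ->; last exact/eqP.
have e (s : seq 'I_2) : count_mem 0%R s = (size s - count_mem 1%R s)%N.
  rewrite -(count_predC (pred1 1%R) s) addKn; apply: eq_count => y.
  by case: (ord2_cases y) => ->.
by rewrite !e hs hc.
Qed.

Lemma count_permute l (s : 'S_l) (i : l.-tuple 'I_2) :
  count_mem 1%R (permute s i) = count_mem 1%R i.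
Proof. by apply: seq.permP; apply/tuple_permP; exists s. Qed.

(** Words with equally many ones are permutations of each other, and a translation of the symmetric
    group absorbs the permutation. *)
Lemma sum_permute l (i j k : l.-tuple 'I_2) :
  count_mem 1%R i = count_mem 1%R j ->
  \sum_(s : 'S_l) word (permute s i) k = \sum_(s : 'S_l) word (permute s j) k.
Proof.
move=> hc; have /tuple_permP[t ht] : perm_eq i j.
  by apply: perm_eq_count; rewrite ?size_tuple.
have -> : i = permute t j by exact/val_inj.
rewrite [RHS](reindex_inj (mulIg t)).
by apply: eq_bigr => s _; congr (word (tval _) _); rewrite -permuteM.
Qed.

Hypothesis nat_reg : forall (n : nat) (a : A), (0 < n)%N -> a *+ n = 0 -> a = 0.
Hypothesis Mmanin : forall k, manin (M k.+1) (M k).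

(** The left side is l! times the trace of the symmetriser applied to the fused product. Averaging
    the rows over permutations is the same as averaging them over all words with the same number of
    ones. *)
Lemma sym_trace l :
  \sum_(k : l.-tuple 'I_2) \sum_(s : 'S_l) word (permute s k) k
  = fused_trace M l *+ l`!.
Proof.
have two_reg (a : A) : a *+ 2 = 0 -> a = 0 by exact: nat_reg.
have hcount (k : l.-tuple 'I_2) : (count_mem 1%R k < l.+1)%N.
  by rewrite ltnS -[X in (_ <= X)%N](size_tuple k) count_size.
rewrite (partition_big (fun k : l.-tuple 'I_2 => Ordinal (hcount k)) predT) //=.
rewrite /fused_trace -sumrMnl; apply: eq_bigr => r _.
(* The number of words with r ones. Both sides are multiplied by c: on the right this restores the
   sum over all columns of the class, on the left it allows the rows to run over the whole class;
   [nat_reg] cancels c. *)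
set c := #|[pred k : l.-tuple 'I_2 | count_mem 1%R k == r]|.
have hc : (0 < c)%N.
  apply/card_gt0P; have hs : size (nseq (l - r) 0 ++ nseq r 1 : seq 'I_2) == l.
    by rewrite size_cat !size_nseq subnK // -ltnS.
  exists (Tuple hs); rewrite inE /= count_cat !count_nseq /=.
  by rewrite mul0n mul1n.
apply/eqP; rewrite -subr_eq0; apply/eqP; apply: (nat_reg hc).
rewrite mulrnBl; apply/eqP; rewrite subr_eq0; apply/eqP.
rewrite -mulrnA mulnC mulrnA.
have -> : ordered_entry M l r r *+ c
  = \sum_(k : l.-tuple 'I_2 | count_mem 1%R k == r) fused_entry M k r.
  rewrite -sumr_const; apply: eq_big => k //= /eqP hk.
  by rewrite fused_entry_ordered // size_tuple hk.
rewrite -!sumrMnl; apply: eq_bigr => k /eqP hk.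
have {}hk : count_mem 1%R k = r by have := congr1 val hk.
rewrite fused_entry_sum -sumr_const.
transitivity (\sum_(i : l.-tuple 'I_2 | count_mem 1%R i == r)
    \sum_(s : 'S_l) word (permute s i) k).
  by apply: eq_big => i //= /eqP hi; apply: sum_permute; rewrite hk hi.
rewrite exchange_big /= -card_Sn -sumr_const; apply: eq_big => s //= _.
rewrite [RHS](reindex_onto (permute s) (permute s^-1%g)) /=; last first.
  by move=> i _; rewrite permuteM mulgV permute1.
apply: eq_bigl => i.
by rewrite count_permute permuteM mulVg permute1 eqxx andbT.
Qed.

End Words.

(** * Matrix entries of products of one-site operators *)

Section OnSite.

Variables (R : pzRingType) (p : nat) (d : 'I_p -> nat).

Lemma mindex_inj : injective (@mindex p d).
Proof. exact: enum_val_inj. Qed.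

Lemma mindexK (f : tidx d) : mindex (enum_rank f : 'I_(tdim d)) = f.
Proof. exact: enum_rankK. Qed.

Lemma on_site_prod (B : forall n, 'M[R]_(d n)) (s : seq 'I_p)
    (i j : 'I_(tdim d)) : uniq s ->
  (\prod_(n <- s) on_site (B n)) i j
  = if [forall m, (m \notin s) ==> (mindex i m == mindex j m)]
    then \prod_(n <- s) B n (mindex i n) (mindex j n) else 0.
Proof.
elim: s i j => [|a s IHs] i j /=.
  move=> _; rewrite !big_nil mxE; case: eqVneq => [->|hij].
    by case: forallP => // h; case: h => m; rewrite eqxx implybT.
  case: forallP => // h; case/negP: hij; apply/eqP/mindex_inj/ffunP => m.
  exact: (eqP (h m)).
move=> /andP[ha hs]; rewrite !big_cons -mulmxE mxE.
(* The only intermediate index that contributes: the factor at [a] has already been applied, those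
   in [s] have not. *)
pose m0 : 'I_(tdim d) :=
  enum_rank ([ffun k => if k == a then mindex j k else mindex i k] : tidx d).
have m0E k : mindex m0 k = if k == a then mindex j k else mindex i k.
  by rewrite mindexK ffunE.
rewrite (bigD1 m0) //= [X in _ + X]big1 ?addr0; last first.
  move=> m hm; rewrite mxE IHs //.
  case: forallP => [h1 | _]; last by rewrite mul0r.
  case: forallP => [h2 | _]; last by rewrite mulr0.
  case/negP: hm; apply/eqP/mindex_inj/ffunP => k; rewrite m0E.
  case: eqVneq => [-> | hk]; first by apply/eqP; apply: (implyP (h2 a)).
  by apply/esym/eqP; apply: (implyP (h1 k)).
rewrite mxE IHs // m0E eqxx.
have -> : [forall m, (m != a) ==> (mindex i m == mindex m0 m)].
  by apply/forallP => m; rewrite m0E; case: (m == a) => /=.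
have -> : [forall m, (m \notin s) ==> (mindex m0 m == mindex j m)]
        = [forall m, (m \notin a :: s) ==> (mindex i m == mindex j m)].
  apply: eq_forallb => m; rewrite m0E inE negb_or.
  by case: (eqVneq m a) => [-> | _] /=; rewrite ?eqxx ?implybT.
case: ifP => _; last by rewrite mulr0.
congr (_ * _); rewrite big_seq [RHS]big_seq; apply: eq_bigr => n hn.
by rewrite m0E; case: (eqVneq n a) => // hna; rewrite -hna hn in ha.
Qed.

Lemma on_siteE (B : forall n, 'M[R]_(d n)) (i j : 'I_(tdim d)) :
  (\prod_n on_site (B n)) i j = \prod_n B n (mindex i n) (mindex j n).
Proof.
rewrite on_site_prod ?index_enum_uniq //.
by case: forallP => // h; case: h => m; rewrite mem_index_enum.
Qed.

End OnSite.

(** The order is reversed because permutations compose from left to right: (t * s) k is s (t k). *)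
Lemma perm_opM (C : numClosedFieldType) (l : nat) (s t : 'S_l) :
  perm_op C s * perm_op C t = perm_op C (t * s)%g.
Proof.
apply/matrixP => i j; rewrite -mulmxE mxE.
pose m0 : 'I_(tdim (@aux_dim l)) :=
  enum_rank ([ffun k => mindex i (s k)] : tidx (@aux_dim l)).
have m0E k : mindex m0 k = mindex i (s k) by rewrite mindexK ffunE.
rewrite (bigD1 m0) //= [X in _ + X]big1 ?addr0; last first.
  move=> m hm; rewrite !mxE; case: forallP => [h|]; last by rewrite mul0r.
  case/negP: hm; apply/eqP/mindex_inj/ffunP => k; rewrite m0E.
  by apply/esym/eqP/h.
rewrite !mxE; case: forallP => [_|[]]; last by move=> k; rewrite m0E.
rewrite mul1r; congr (_%:R); congr nat_of_bool; apply: eq_forallb => k.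
by rewrite m0E permM.
Qed.

Lemma sym_projM (C : numClosedFieldType) (l : nat) :
  sym_proj C l *m sym_proj C l = sym_proj C l.
Proof.
rewrite /sym_proj -scalemxAl -scalemxAr mulmx_suml.
rewrite (eq_bigr (fun=> \sum_(s : 'S_l) perm_op C s)); last first.
  move=> s _; rewrite mulmx_sumr [RHS](reindex_inj (mulIg s)).
  by apply: eq_bigr => t _; exact: perm_opM.
rewrite sumr_const card_Sn -scaler_nat !scalerA -mulrA mulVf ?mulr1 //.
by rewrite pnatr_eq0 -lt0n fact_gt0.
Qed.

Section FusedTransfer.

Variables (C : numClosedFieldType) (eta : C) (N : nat) (e : 'I_N -> nat).
Variables (xi : 'I_N -> C) (K : 'M[C]_2).

Local Notation endH := (endH C e).
Local Notation scal := (fun c : C => c%:M : endH).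

Lemma scalar_endH_comm (c : C) (X : endH) : (c%:M : endH) * X = X * c%:M.
Proof. exact: (esym (scalar_mxC _ _)). Qed.

Lemma endH_natmul_reg (n : nat) (X : endH) : (0 < n)%N -> X *+ n = 0 -> X = 0.
Proof.
move=> hn /matrixP h; apply/matrixP => i j; have := h i j.
rewrite mulmxnE [RHS]mxE => /eqP; rewrite mulrn_eq0 => /orP[/eqP hn0 | /eqP ->].
  by rewrite hn0 in hn.
by rewrite mxE.
Qed.

(** The entries of P are scalars, hence central, so P may be moved around the trace although the
    entries of X do not commute; idempotence then leaves a single P. *)
Lemma sym_proj_trace (l : nat) (X : 'M[endH]_(tdim (@aux_dim l))) :
  let P := map_mx scal (sym_proj C l) in
  \tr (P * X * P) *+ l`!
  = \sum_k \sum_(s : 'S_l)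
      X (enum_rank ([ffun m => mindex k (s m)] : tidx (@aux_dim l))) k.
Proof.
move=> P; have PE i j : P i j = (sym_proj C l i j)%:M by rewrite mxE.
have -> : \tr (P * X * P)
    = \sum_k \sum_j (sym_proj C l k j)%:M * X j k.
  rewrite /mxtrace.
  under eq_bigr => i _.
    rewrite -mulmxE mxE; under eq_bigr => k _.
      rewrite mxE mulr_suml; under eq_bigr => j _.
        rewrite !PE -mulrA -scalar_endH_comm mulrA.
        rewrite -[_ * _%:M]scalar_endH_comm -[_%:M * _]scalar_mxM.
      over.
    over.
  over.
  rewrite exchange_big; apply: eq_bigr => k _ /=.
  rewrite exchange_big; apply: eq_bigr => j _ /=.
  by rewrite -mulr_suml -raddf_sum -[in RHS]sym_projM mxE.
rewrite -sumrMnl; apply: eq_bigr => k _.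
rewrite -sumrMnl /=.
rewrite [RHS](eq_bigr (fun s : 'S_l => \sum_j (perm_op C s k j)%:M * X j k)).
  rewrite exchange_big; apply: eq_bigr => j _ /=.
  rewrite -mulr_suml -raddf_sum /sym_proj mxE summxE -mulrnAl; congr (_ * _).
  rewrite -(raddfMn (@scalar_mx C (hdim e))) /= -mulrnAl -mulr_natl mulfV ?mul1r //.
  by rewrite pnatr_eq0 -lt0n fact_gt0.
move=> s _; set m0 := enum_rank _.
have m0E m : mindex m0 m = mindex k (s m) by rewrite mindexK ffunE.
rewrite (bigD1 m0) //= [X in _ + X]big1 ?addr0; last first.
  move=> m hm; rewrite mxE; case: forallP => [h|]; last by rewrite raddf0 mul0r.
  case/negP: hm; apply/eqP/mindex_inj/ffunP => j; rewrite m0E.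
  by apply/esym/eqP/h.
rewrite mxE; case: forallP => [_|[]]; last by move=> j; rewrite m0E.
by rewrite mul1r.
Qed.

Definition monodromy_at (lambda : C) (k : nat) : 'M[endH]_2 :=
  monodromy eta e xi K (lambda + k%:R * eta).

Lemma fused_transfer_trace (lambda : C) (l : nat) :
  (forall k, manin (monodromy_at lambda k.+1) (monodromy_at lambda k)) ->
  fused_transfer eta e xi K l lambda = fused_trace (monodromy_at lambda) l.
Proof.
move=> hM; case: l => [|l]; first by rewrite fused_trace0.
apply/eqP; rewrite -subr_eq0; apply/eqP.
apply: (@endH_natmul_reg (l.+1)`!); first exact: fact_gt0.
rewrite mulrnBl; apply/eqP; rewrite subr_eq0; apply/eqP.
rewrite -sym_trace //; last exact: endH_natmul_reg.
rewrite /fused_transfer sym_proj_trace.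
pose tup (k : 'I_(tdim (@aux_dim l.+1))) : l.+1.-tuple 'I_2 :=
  [tuple (mindex k m : 'I_2) | m < l.+1].
rewrite [RHS](reindex tup); last first.
  exists (fun t : l.+1.-tuple 'I_2 =>
    enum_rank (finfun (fun m => tnth t m : 'I_(@aux_dim l.+1 m)) : tidx (@aux_dim l.+1))).
    move=> k _; apply/mindex_inj/ffunP => m.
    by rewrite mindexK ffunE tnth_mktuple.
  move=> t _; apply: eq_from_tnth => m.
  by rewrite tnth_mktuple mindexK ffunE.
apply: eq_bigr => k _; apply: eq_bigr => s _.
rewrite on_siteE.
rewrite -[LHS]/(\prod_(m < l.+1) monodromy_at lambda (rev_ord m) _ _).
rewrite (word_codom (monodromy_at lambda)).
congr word; apply: (eq_codom (g := fun m => tnth (tup k) (s m))) => m.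
by rewrite mindexK ffunE tnth_mktuple.
Qed.

End FusedTransfer.

(** * The exchange relation *)

Section Exchange.

Variable A : pzRingType.

Implicit Types (t u v : 'M[A]_2).

(** Satisfied by operators on different sites and by a twist with scalar entries. *)
Definition ecomm t u : Prop := forall i j k l : 'I_2,
  t i j * u k l = u k l * t i j.

Lemma ecommC t u : ecomm t u -> ecomm u t.
Proof. by move=> h i j k l; rewrite h. Qed.

Lemma ecomm_mul t u v : ecomm t u -> ecomm t v -> ecomm t (u * v).
Proof.
move=> hu hv i j k l; rewrite -mulmxE mxE mulr_sumr mulr_suml.
by apply: eq_bigr => p _; rewrite mulrA hu -mulrA hv mulrA.
Qed.

Lemma ecomm_prod (I : Type) (s : seq I) (P : pred I) t (F : I -> 'M[A]_2) :
  (forall n, P n -> ecomm t (F n)) -> ecomm t (\prod_(n <- s | P n) F n).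
Proof.
move=> h; elim/big_rec: _ => [i j k l | n x hn hx].
  by rewrite mxE; case: (k == l); rewrite ?mulr0 ?mul0r ?mulr1 ?mul1r.
exact: ecomm_mul (h n hn) hx.
Qed.

Definition rtt (c h : A) t u : Prop := forall i j k l : 'I_2,
  c * (t i j * u k l) + h * (t k j * u i l)
  = c * (u k l * t i j) + h * (u k j * t i l).

Lemma rtt_mul c h t u t' u' :
  (forall x, c * x = x * c) -> (forall x, h * x = x * h) ->
  ecomm t' u -> ecomm t u' ->
  rtt c h t u -> rtt c h t' u' -> rtt c h (t * t') (u * u').
Proof.
move=> hc hh h1 h2 r1 r2.
have expand (x : A) (a b : 'M[A]_2) (a' b' : 'M[A]_2) (i j k l : 'I_2) :
    ecomm a' b ->
    x * ((a * a') i j * (b * b') k l)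
    = \sum_p \sum_q x * (a i p * b k q) * (a' p j * b' q l).
  move=> hab; rewrite -!mulmxE !mxE mulr_suml mulr_sumr; apply: eq_bigr => p _.
  rewrite !mulr_sumr; apply: eq_bigr => q _; rewrite -!mulrA; congr (_ * (_ * _)).
  by rewrite !mulrA hab.
move=> i j k l; rewrite !expand //; try exact: ecommC.
rewrite -big_split -[RHS]big_split /=.
under eq_bigr => p _.
  rewrite -big_split /=; under eq_bigr => q _ do rewrite -mulrDl r1 mulrDl.
  rewrite big_split; over.
(* Interchanging p and q in the flipped term puts u_kq t_ip in front of both terms; the remaining
   factors form the left side of the second relation. *)
rewrite big_split /= [X in _ + X]exchange_big -big_split /=.
rewrite [RHS]big_split /= [X in _ = X + _]exchange_big.
rewrite [X in _ = _ + X]exchange_big -[RHS]big_split /=.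
apply: eq_bigr => p _; rewrite -[LHS]big_split -[RHS]big_split /=.
apply: eq_bigr => q _.
have pull (x y z : A) : (forall w, x * w = w * x) -> x * y * z = y * (x * z).
  by move=> hx; rewrite hx mulrA.
by rewrite !(pull c) // !(pull h) // -!mulrDr r2.
Qed.

Lemma rtt_prod c h (I : eqType) (s : seq I) (F G : I -> 'M[A]_2) :
  (forall x, c * x = x * c) -> (forall x, h * x = x * h) ->
  (forall m n, m != n -> ecomm (F m) (G n)) ->
  (forall n, rtt c h (F n) (G n)) -> uniq s ->
  rtt c h (\prod_(n <- s) F n) (\prod_(n <- s) G n).
Proof.
move=> hc hh hFG hr; elim: s => [_ | a s IHs /= /andP[ha hs]].
  rewrite !big_nil => i j k l; rewrite !mxE.
  by do 4 ![case: eqP => _]; rewrite ?(mulr0, mul0r, mulr1, mul1r).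
rewrite !big_cons; apply: rtt_mul => //; last exact: IHs.
- apply: ecommC; rewrite big_seq; apply: ecomm_prod => n hn; apply: ecommC.
  by apply: hFG; apply: contraNneq ha => <-.
- rewrite big_seq; apply: ecomm_prod => n hn; apply: hFG.
  by apply: contraNneq ha => ->.
Qed.

(** For c = h the right side of the exchange relation is symmetric in j and l, hence so is the left
    side. *)
Lemma rtt_manin h t u : (forall x, h * x = 0 -> x = 0) -> rtt h h t u -> manin t u.
Proof.
move=> hreg r.
have E i j k l : t i j * u k l + t k j * u i l = u k l * t i j + u k j * t i l.
  apply/eqP; rewrite -subr_eq0; apply/eqP/hreg.
  by rewrite mulrBr !mulrDr r subrr.
by move=> i j k l; rewrite !E addrC.
Qed.

(** Let E be the commutator of the traces and D the sum of the commutators of t_ik and u_ki. The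
    relation gives c E = - h D and c D = - h E. *)
Lemma rtt_trace c h t u :
  (forall x, c * x = x * c) -> (forall x, h * x = x * h) -> rtt c h t u ->
  (c * c - h * h) * (\tr t * \tr u - \tr u * \tr t) = 0.
Proof.
move=> hc hh r.
have r' i j k l : c * (t i j * u k l - u k l * t i j)
    = h * (u k j * t i l - t k j * u i l).
  rewrite !mulrBr; apply/eqP; rewrite subr_eq addrAC -subr_eq opprK.
  by rewrite r addrC.
have trM (a b : 'M[A]_2) : \tr a * \tr b = \sum_i \sum_k a i i * b k k.
  by rewrite /mxtrace mulr_suml; apply: eq_bigr => i _; rewrite mulr_sumr.
have trMC (a b : 'M[A]_2) : \tr a * \tr b = \sum_i \sum_k a k k * b i i.
  by rewrite trM exchange_big.
set D := \sum_i \sum_k (t i k * u k i - u k i * t i k).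
have sumB2 (f g : 'I_2 -> 'I_2 -> A) :
    \sum_i \sum_k f i k - \sum_i \sum_k g i k
    = \sum_i \sum_k (f i k - g i k).
  by rewrite -sumrB; apply: eq_bigr => i _; rewrite -sumrB.
have mul2 x (f : 'I_2 -> 'I_2 -> A) :
    x * (\sum_i \sum_k f i k) = \sum_i \sum_k x * f i k.
  by rewrite mulr_sumr; apply: eq_bigr => i _; rewrite mulr_sumr.
have eq2 (f g : 'I_2 -> 'I_2 -> A) : (forall i k, f i k = g i k) ->
    \sum_i \sum_k f i k = \sum_i \sum_k g i k.
  by move=> h'; apply: eq_bigr => i _; apply: eq_bigr.
have E1 : c * (\tr t * \tr u - \tr u * \tr t) = - (h * D).
  rewrite trM trMC sumB2 mul2 (eq2 _ _ (fun i k => r' i i k k)) -mul2 -mulrN.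
  by rewrite /D -!sumB2 opprB; congr (_ * (_ - _)); rewrite exchange_big.
have E2 : c * D = - (h * (\tr t * \tr u - \tr u * \tr t)).
  rewrite /D mul2 (eq2 _ _ (fun i k => r' i k k i)) -mul2 -mulrN opprB.
  by rewrite -sumB2 trMC [in RHS]trMC [X in _ - X]exchange_big.
by rewrite mulrBl -!mulrA E1 mulrN mulrA hc -mulrA E2 mulrN opprK subrr.
Qed.

(** After expansion the inner factor t'_p1 u'_q0 - t'_p0 u'_q1 is antisymmetric in p and q: it
    vanishes for p = q and is plus or minus the quantum determinant of the second pair otherwise. *)
Lemma qdet_mul t u t' u' : (forall a : A, a *+ 2 = 0 -> a = 0) ->
  ecomm t' u -> manin t' u' ->
  qdet (t * t') (u * u') = qdet t u * qdet t' u'.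
Proof.
move=> h2 hc hm.
have E i j : (t * t') 1 i * (u * u') 0 j
    = \sum_p \sum_q t 1 p * u 0 q * (t' p i * u' q j).
  rewrite -!mulmxE !mxE mulr_suml; apply: eq_bigr => p _.
  rewrite mulr_sumr; apply: eq_bigr => q _.
  by rewrite -!mulrA; congr (_ * _); rewrite !mulrA hc.
have -> : qdet (t * t') (u * u')
    = \sum_p \sum_q t 1 p * u 0 q * (t' p 1 * u' q 0 - t' p 0 * u' q 1).
  rewrite /qdet !E -sumrB; apply: eq_bigr => p _.
  by rewrite -sumrB; apply: eq_bigr => q _; rewrite mulrBr.
rewrite !sum_two (manin_row h2 0 1 0 hm) (manin_row h2 1 1 0 hm) !subrr !mulr0.
have -> : t' 0 1 * u' 1 0 - t' 0 0 * u' 1 1 = - qdet t' u'.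
  have h := hm 0 1 1 0; apply/eqP; rewrite /qdet opprB subr_eq addrAC eq_sym.
  by rewrite subr_eq h addrC.
by rewrite add0r addr0 mulrN addrC -mulrBl.
Qed.

Lemma ecomm_fused_entry (M : nat -> 'M[A]_2) t (j : seq 'I_2) r :
  (forall k, ecomm t (M k)) ->
  forall a b, t a b * fused_entry M j r = fused_entry M j r * t a b.
Proof.
move=> h a b; elim: j r => [|x j IHj] r /=.
  by case: (r == 0%N); rewrite ?mulr0 ?mul0r ?mulr1 ?mul1r.
rewrite mulrDr mulrDl !mulrA !h -!mulrA IHj; congr (_ + _ * _).
by case: r => [|r] /=; rewrite ?mulr0 ?mul0r.
Qed.

Section FusedProduct.

Variables M M' : nat -> 'M[A]_2.
Hypothesis two_reg : forall a : A, a *+ 2 = 0 -> a = 0.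
Hypothesis Mmanin : forall k, manin (M k.+1) (M k).
Hypothesis MM' : forall k k', ecomm (M k) (M' k').

(** Multiplication on the symmetric power: the intermediate word is a column word of M, so it enters
    M only through its number p of ones, and summing M' over the words with p ones gives its fused
    entry. *)
Lemma fused_entry_mul (j : seq 'I_2) r :
  fused_entry (fun k => M k * M' k) j r
  = \sum_(p < (size j).+1) ordered_entry M (size j) p r * fused_entry M' j p.
Proof.
elim: j r => [|x j IHj] r; first by rewrite big_ord1 mulr1.
set l := size j.
have pv : pred_val (fused_entry (fun k => M k * M' k) j) r
   = \sum_(p < l.+1) pred_val (ordered_entry M l p) r * fused_entry M' j p.
  by case: r => [|r] /=; [rewrite big1 // => p _; rewrite mul0r | exact: IHj].
rewrite [LHS]/= IHj pv -/l -mulmxE !mxE !sum_two !mulr_sumr -big_split.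
have hO (m : 'I_2) (p : nat) r' :
    M' l m x * ordered_entry M l p r' = ordered_entry M l p r' * M' l m x.
  by apply: ecomm_fused_entry => k; apply/ecommC/MM'.
have hO' (m : 'I_2) (p : nat) : M' l m x * pred_val (ordered_entry M l p) r
    = pred_val (ordered_entry M l p) r * M' l m x.
  by case: r {pv} => [|r] /=; rewrite ?mulr0 ?mul0r.
have step (p : 'I_l.+1) :
  (M l 0 0 * M' l 0 x + M l 0 1 * M' l 1 x) *
    (ordered_entry M l p r * fused_entry M' j p) +
  (M l 1 0 * M' l 0 x + M l 1 1 * M' l 1 x) *
    (pred_val (ordered_entry M l p) r * fused_entry M' j p)
  = ordered_entry M l.+1 p r * (M' l 0 x * fused_entry M' j p)
    + ordered_entry M l.+1 p.+1 r * (M' l 1 x * fused_entry M' j p).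
  have hp : (p <= l)%N by rewrite -ltnS.
  rewrite ordered_entry0 // ordered_entry1 // !mulrDl addrACA.
  by congr (_ + _ + (_ + _)); rewrite -!mulrA; congr (_ * _);
     rewrite !mulrA ?hO ?hO'.
rewrite (eq_bigr _ (fun p _ => step p)) big_split /=.
under [RHS]eq_bigr => p _ do rewrite mulrDr.
rewrite big_split /=; congr (_ + _).
  by rewrite [RHS]big_ord_recr /= fused_entry_large // !mulr0 addr0.
by rewrite [RHS]big_ord_recl /= !mulr0 add0r.
Qed.

Definition fused_null (F : nat -> 'M[A]_2) (l : nat) : Prop :=
  forall j : seq 'I_2, size j = l -> forall r, fused_entry F j r = 0.

Lemma fused_null_mull l : fused_null M l -> fused_null (fun k => M k * M' k) l.
Proof.
move=> h j hj r; rewrite fused_entry_mul hj big1 // => p _.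
by rewrite /ordered_entry h ?mul0r // size_cat !size_nseq subnK // -ltnS.
Qed.

Lemma fused_null_mulr l : fused_null M' l -> fused_null (fun k => M k * M' k) l.
Proof.
by move=> h j hj r; rewrite fused_entry_mul big1 // => p _; rewrite h ?mulr0.
Qed.

End FusedProduct.

End Exchange.

(** * Spin operators *)

Section OnSiteMorphism.

Variables (R : comPzRingType) (p : nat) (d : 'I_p -> nat).

Lemma on_siteD n (A B : 'M[R]_(d n)) : on_site (A + B) = on_site A + on_site B.
Proof.
by apply/matrixP => i j; rewrite !mxE; case: ifP => _; rewrite ?mxE ?addr0.
Qed.

Lemma on_siteZ n c (A : 'M[R]_(d n)) : on_site (c *: A) = c *: on_site A.
Proof.
by apply/matrixP => i j; rewrite !mxE; case: ifP => _; rewrite ?mxE ?mulr0.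
Qed.

Lemma on_site_scalar n c : on_site (c%:M : 'M[R]_(d n)) = c%:M.
Proof.
apply/matrixP => i j; rewrite !mxE; case: (eqVneq i j) => [->|hij].
  by case: forallP => [_|[]]; rewrite ?eqxx // => m; rewrite eqxx implybT.
case: forallP => // h; case: eqP => // hn; case/negP: hij.
apply/eqP/mindex_inj/ffunP => m; case: (eqVneq m n) => [->//|hm].
by have := h m; rewrite hm => /eqP.
Qed.

Lemma on_siteM n (A B : 'M[R]_(d n)) : on_site (A *m B) = on_site A *m on_site B.
Proof.
apply/matrixP => i j; rewrite !mxE.
pose up (x : 'I_(d n)) : 'I_(tdim d) :=
  enum_rank (finfun (dfwith (mindex i) x) : tidx d).
have upn x : mindex (up x) n = x by rewrite mindexK ffunE dfwith_in.
have upm x m : m != n -> mindex (up x) m = mindex i m.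
  by move=> hm; rewrite mindexK ffunE dfwith_out // eq_sym.
rewrite (bigID (fun m => up (mindex m n) == m)) /= [X in _ = _ + X]big1 ?addr0.
  rewrite (reindex_onto up (fun m => mindex m n)); last by move=> m /eqP.
  rewrite [RHS](eq_bigl predT) => [|x]; last by rewrite !upn !eqxx.
  case: ifP => h.
    apply: eq_bigr => x _; rewrite !mxE upn.
    have -> : [forall m, (m != n) ==> (mindex i m == mindex (up x) m)].
      by apply/forallP => m; apply/implyP => hm; rewrite upm.
    have -> // : [forall m, (m != n) ==> (mindex (up x) m == mindex j m)].
    apply/forallP => m; apply/implyP => hm; rewrite upm //.
    by move/forallP/(_ m): h; rewrite hm.
  rewrite big1 // => x _; rewrite !mxE; case: ifP => _; last by rewrite mul0r.
  case: ifP => [h'|_]; last by rewrite mulr0.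
  move/negP: h; case; apply/forallP => m; apply/implyP => hm.
  by move/forallP/(_ m): h'; rewrite hm upm.
move=> m hm; rewrite !mxE; case: forallP => [h|_]; last by rewrite mul0r.
case/negP: hm; apply/eqP/mindex_inj/ffunP => k.
case: (eqVneq k n) => [->|hk]; first by rewrite upn.
by rewrite upm //; have := h k; rewrite hk => /eqP.
Qed.

Lemma on_site_comm n m (A : 'M[R]_(d n)) (B : 'M[R]_(d m)) : n != m ->
  on_site A *m on_site B = on_site B *m on_site A.
Proof.
(* A dependent family with A at n and B at m makes both products instances of [on_site_prod]. *)
move=> hnm; pose F : forall k, 'M[R]_(d k) :=
  dfwith (dfwith (fun k => 0 : 'M[R]_(d k)) A) B.
have Fm : F m = B by rewrite /F dfwith_in.
have Fn : F n = A by rewrite /F dfwith_out 1?eq_sym // dfwith_in.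
have hm : uniq [:: n; m] by rewrite /= inE hnm.
have hm' : uniq [:: m; n] by rewrite /= inE eq_sym hnm.
apply/matrixP => i j.
have := on_site_prod F i j hm; have := on_site_prod F i j hm'.
rewrite !big_cons !big_nil !mulr1 Fn Fm -!mulmxE => -> ->.
have -> : [forall k, (k \notin [:: m; n]) ==> (mindex i k == mindex j k)]
       = [forall k, (k \notin [:: n; m]) ==> (mindex i k == mindex j k)].
  by apply: eq_forallb => k; rewrite !inE orbC.
by rewrite mulrC.
Qed.

End OnSiteMorphism.

Section SpinAlgebra.

Variables (C : numClosedFieldType) (e : nat).

Local Notation Sz := (spin_z C e).
Local Notation Sp := (spin_plus C e).
Local Notation Sm := (spin_minus C e).

Lemma spin_zE i j : Sz i j = (half_spin C e - i%:R) *+ (i == j).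
Proof. by rewrite mxE; case: (i == j). Qed.

Lemma mul_spin_z_l (A : 'M[C]_e.+1) i j :
  (Sz *m A) i j = (half_spin C e - i%:R) * A i j.
Proof.
rewrite mxE (bigD1 i) //= spin_zE eqxx big1 ?addr0 // => k hk.
by rewrite spin_zE eq_sym (negbTE hk) mul0r.
Qed.

Lemma mul_spin_z_r (A : 'M[C]_e.+1) i j :
  (A *m Sz) i j = A i j * (half_spin C e - j%:R).
Proof.
rewrite mxE (bigD1 j) //= spin_zE eqxx big1 ?addr0 // => k hk.
by rewrite spin_zE (negbTE hk) mulr0.
Qed.

Lemma spin_plusE i j : Sp i j = sqrtC (i.+1 * (e - i))%:R *+ (j == i.+1 :> nat).
Proof. by rewrite mxE; case: (_ == _). Qed.

Lemma spin_z_plus : Sz *m Sp - Sp *m Sz = Sp.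
Proof.
apply/matrixP => i j; rewrite mxE [X in _ + X]mxE mul_spin_z_l mul_spin_z_r spin_plusE.
case: eqP => [->|_]; last by rewrite !mulr0n mul0r mulr0 subrr.
rewrite mulr1n mulrC -mulrBr -[RHS]mulr1; congr (_ * _).
by rewrite -natr1 opprB addrC !addrA addrNK addrAC subrr add0r.
Qed.

Lemma spin_z_minus : Sz *m Sm - Sm *m Sz = - Sm.
Proof.
apply: trmx_inj; rewrite linearN linearB /= !trmx_mul trmxK.
have -> : Sz^T = Sz.
  apply/matrixP => i j; rewrite mxE !spin_zE eq_sym.
  by case: eqP => [->|_].
by rewrite -[in RHS]spin_z_plus opprB.
Qed.

Lemma spin_plus_minus i j :
  (Sp *m Sm) i j = (i.+1 * (e - i))%:R *+ (i == j).
Proof.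
rewrite mxE; case: (ltnP i e) => hi; last first.
  have -> : (e - i = 0)%N by apply/eqP; rewrite subn_eq0.
  rewrite muln0 mul0rn big1 // => k _; rewrite spin_plusE.
  case: eqP => [hk|_]; last by rewrite mul0r.
  by have := ltn_ord k; rewrite hk ltnS ltnNge hi.
have hi' : (i.+1 < e.+1)%N by [].
rewrite (bigD1 (Ordinal hi')) //= [Sm _ _]mxE !spin_plusE /= eqxx eqSS.
rewrite big1 ?addr0; last first.
  move=> k hk; rewrite spin_plusE; case: eqP => [hk'|_]; last by rewrite mul0r.
  by case/negP: hk; apply/eqP/val_inj.
rewrite -(inj_eq val_inj) /=; case: eqP => [->|_]; last by rewrite mulr0.
by rewrite !mulr1n -expr2 sqrtCK.
Qed.

Lemma spin_minus_plus i j :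
  (Sm *m Sp) i j = (i * (e.+1 - i))%:R *+ (i == j).
Proof.
rewrite mxE; case: i => [[|i] hi]; last first.
  have hi' : (i < e.+1)%N by exact: ltnW.
  rewrite (bigD1 (Ordinal hi')) //= [Sm _ _]mxE !spin_plusE /= eqxx.
  rewrite big1 ?addr0; last first.
    move=> k hk; rewrite [Sm _ _]mxE spin_plusE /=.
    case: eqP => [[hk']|_]; last by rewrite mul0r.
    by case/negP: hk; apply/eqP/val_inj.
  rewrite -(inj_eq val_inj) /= eq_sym subSS; case: eqP => [->|_]; last by rewrite mulr0.
  by rewrite !mulr1n -expr2 sqrtCK.
by rewrite mul0n mul0rn big1 // => k _; rewrite [Sm _ _]mxE spin_plusE mul0r.
Qed.

Lemma spin_plus_minus_comm : Sp *m Sm - Sm *m Sp = Sz *+ 2.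
Proof.
apply/matrixP => i j; rewrite mxE [X in _ + X]mxE spin_plus_minus.
rewrite spin_minus_plus mulmxnE spin_zE -mulrnBl mulrnAC; congr (_ *+ _).
have hi : (i <= e)%N by rewrite -ltnS.
rewrite subSn // !natrM -!natr1 natrB // /half_spin.
have h2 : 2%:R != 0 :> C by rewrite pnatr_eq0.
by field.
Qed.

End SpinAlgebra.

(** * The Lax operator of a single spin *)

Section LocalLax.

Variables (C : numClosedFieldType) (e : nat).

Local Notation Sz := (spin_z C e).
Local Notation Sp := (spin_plus C e).
Local Notation Sm := (spin_minus C e).
Local Notation endV := ('M[C]_e.+1).

Definition sl2_mx : 'M[endV]_2 :=
  \matrix_(i, j) if i == 0 then (if j == 0 then Sz else Sm)
                 else (if j == 0 then Sp else - Sz).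

(** The coefficient b equals eta in the chain. It is kept free because the genericity argument
    rescales it site by site and lets it become 0. *)
Definition lax_mx (c b : C) : 'M[endV]_2 :=
  \matrix_(i, j) ((c * (i == j)%:R) *: 1%:M + b *: sl2_mx i j).

Lemma sl2_mx_comm (i j k l : 'I_2) :
  sl2_mx i j *m sl2_mx k l - sl2_mx k l *m sl2_mx i j
  = (i == l)%:R *: sl2_mx k j - (k == j)%:R *: sl2_mx i l.
Proof.
have zp := spin_z_plus C e; have zm := spin_z_minus C e.
have pm := spin_plus_minus_comm C e.
have pz : Sp *m Sz - Sz *m Sp = - Sp by rewrite -opprB zp.
have mz : Sm *m Sz - Sz *m Sm = Sm by rewrite -opprB zm opprK.
have mp : Sm *m Sp - Sp *m Sm = - (Sz *+ 2) by rewrite -opprB pm.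
rewrite /sl2_mx !mxE.
case: (ord2_cases i) => ->; case: (ord2_cases j) => ->;
  case: (ord2_cases k) => ->; case: (ord2_cases l) => -> /=;
  rewrite ?(scale0r, scale1r) ?mulNmx ?mulmxN ?mulNmx ?opprK ?subrr ?subr0 ?sub0r //
    1?[- (_ *m _) + _]addrC ?(zp, zm, pm, pz, mz, mp) ?opprK ?mulr2n ?opprD;
  rewrite ?subrr ?addNr //.
Qed.

Lemma lax_mxE c b i j :
  lax_mx c b i j = (c * (i == j)%:R) *: 1%:M + b *: sl2_mx i j.
Proof. by rewrite mxE. Qed.

(** The quadratic terms of the two flipped products agree, so a single commutator is left; by the
    gl_2 relations it cancels the linear terms, which carry the same factor c - c'. *)
Lemma lax_mx_rtt (c c' b : C) :
  rtt ((c - c')%:M : endV) (b%:M : endV) (lax_mx c b) (lax_mx c' b).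
Proof.
move=> i j k l; rewrite !lax_mxE -!mulmxE.
have := sl2_mx_comm i j k l.
move: (sl2_mx i j) (sl2_mx k l) (sl2_mx k j) (sl2_mx i l) => X Y Z W.
rewrite !mulmxDl !mulmxDr -!scalemxAl -!scalemxAr !mul1mx !mulmx1.
rewrite !mul_scalar_mx.
move: (X *m Y) (Y *m X) (Z *m W) (W *m Z) => XY YX ZW WZ h.
have {h} -> : XY = YX + ((i == l)%:R *: Z - (k == j)%:R *: W) by rewrite -h addrC addrNK.
apply/matrixP => p q; rewrite !mxE -[(c - c') *+ _]mulr_natr -[b *+ _]mulr_natr.
by ring.
Qed.

(** A Casimir computation: the dependence on the weight cancels. For c = lambda - xi + eta/2 and b =
    eta the two factors are those of d(lambda) and a(lambda + eta). *)
Lemma qdet_lax_mx (c b : C) :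
  qdet (lax_mx (c + b) b) (lax_mx c b)
  = ((c - half_spin C e * b) * (c + b + half_spin C e * b))%:M.
Proof.
rewrite /qdet !lax_mxE /= !mulr1 !mulr0 !scale0r !add0r.
rewrite /sl2_mx !mxE /= -!mulmxE.
rewrite !mulmxDl !mulmxDr -!scalemxAl -!scalemxAr !mul1mx !mulmx1.
apply/matrixP => i j.
rewrite mulNmx scalerN scalerN !scalerA.
have hzz := mul_spin_z_l Sz i j; have hpm := spin_plus_minus C i j.
move: (Sz *m Sz) (Sp *m Sm) hzz hpm => ZZ PM hzz hpm.
rewrite !mxE hzz hpm {hzz hpm} !mxE.
case: (eqVneq i j) => _; last first.
  by rewrite !mulr0n !mulr0 !addr0 !oppr0 !mulr0 ?addr0 ?subr0.
have hi : (i <= e)%N by rewrite -ltnS.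
rewrite !mulr1n natrM natrB // -natr1 /half_spin.
have h2 : 2%:R != 0 :> C by rewrite pnatr_eq0.
by field.
Qed.

(* Letter number k kills the k-th basis covector if it is diagonal, and
   raises the index by one if it is the lowering operator. *)
Lemma lax_mx_flag (eta : C) (j : seq 'I_2) (a b : 'I_e.+1) :
  (a < size j)%N ->
  fused_entry (fun k => lax_mx ((k%:R - half_spin C e) * eta) eta) j 0 a b = 0.
Proof.
elim: j a => [|x j IHj] a //=; rewrite mulr0 addr0 ltnS leq_eqVlt => ha.
rewrite -mulmxE lax_mxE mulmxDl -scalemxAl mul1mx -scalemxAl mxE.
set F := fused_entry _ j 0; case: (ord2_cases x) => ->.
  have -> : sl2_mx 0 0 = Sz by rewrite mxE.
  rewrite [X in X + _]mxE [X in _ + X]mxE mul_spin_z_l mulr1.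
  case/orP: ha => [/eqP -> | /IHj]; last by rewrite -/F => ->; rewrite !mulr0 addr0.
  by ring.
have -> : sl2_mx 0 1 = Sm by rewrite mxE.
rewrite mulr0 scale0r [X in X + _]mxE add0r [LHS]mxE [(_ *m _) _ _]mxE.
rewrite big1 ?mulr0 // => m _; rewrite !mxE /=.
case: eqP => [am|_]; last by rewrite mul0r.
rewrite [F m b]IHj ?mulr0 // -ltnS -am.
by case/orP: ha => [/eqP -> | /ltnW].
Qed.

(** The sl_2 invariance of the Lax operator: the commutator with S^+ is a raising operator acting on
    the auxiliary indices. *)
Lemma spin_plus_lax (c b : C) (k l : 'I_2) :
  Sp *m lax_mx c b k l - lax_mx c b k l *m Sp
  = (l == 1)%:R *: lax_mx c b k 0 - (k == 0)%:R *: lax_mx c b 1 l.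
Proof.
rewrite !lax_mxE mulmxDl mulmxDr -!scalemxAl -!scalemxAr mulmx1 mul1mx.
rewrite opprD addrACA subrr add0r -scalerBr.
have -> : Sp = sl2_mx 1 0 by rewrite mxE.
rewrite sl2_mx_comm scalerBr !scalerDr !scalerA.
rewrite opprD addrACA [1 == l]eq_sym.
have -> : (l == 1)%:R * (c * (k == 0)%:R) = (k == 0)%:R * (c * (l == 1)%:R).
  by ring.
by rewrite subrr add0r ![_ * b]mulrC.
Qed.

Section Vanishing.

Variable eta : C.
Hypothesis eta0 : eta != 0.

Let M (k : nat) : 'M[endV]_2 := lax_mx ((k%:R - half_spin C e) * eta) eta.

Lemma endV_two_reg (a : endV) : a *+ 2 = 0 -> a = 0.
Proof.
move=> /eqP; rewrite -scaler_nat scaler_eq0 pnatr_eq0 /= => /eqP //.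
Qed.

Lemma lax_mx_manin (c b : C) : b != 0 -> manin (lax_mx (c + b) b) (lax_mx c b).
Proof.
move=> hb; apply: (@rtt_manin _ (b%:M : endV)).
  move=> x /eqP; rewrite -mulmxE mul_scalar_mx scaler_eq0 (negbTE hb) /=.
  by move/eqP.
by have := @lax_mx_rtt (c + b) c b; rewrite addrAC subrr add0r.
Qed.

Let Mmanin k : manin (M k.+1) (M k).
Proof.
rewrite /M -natr1 addrAC mulrDl mul1r; exact: lax_mx_manin.
Qed.

(** The Leibniz rule carries the invariance of one Lax operator to the symmetric power. The term
    with r + 1 lets vanishing climb from row count r to row count r + 1. *)
Lemma spin_plus_ordered_entry l q r : (q <= l)%N ->
  Sp * ordered_entry M l q r - ordered_entry M l q r * Sp
  = ordered_entry M l q.-1 r *+ q - ordered_entry M l q r.+1 *+ r.+1.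
Proof.
have two := endV_two_reg.
pose br (X : endV) : endV := Sp * X - X * Sp.
have brM X Y : br (X * Y) = br X * Y + X * br Y.
  by rewrite /br mulrBl mulrBr !mulrA addrA addrNK.
have brD X Y : br (X + Y) = br X + br Y.
  by rewrite /br mulrDl mulrDr opprD addrACA.
have brL k (i j : 'I_2) : br (M k i j)
    = (j == 1)%:R *: M k i 0 - (i == 0)%:R *: M k 1 j by exact: spin_plus_lax.
rewrite -/(br _); elim: l q r => [|l IHl] q r hq.
  have -> : q = 0%N by case: q hq.
  rewrite /ordered_entry /= /br.
  by case: r => [|r]; rewrite ?mul0r ?mulr0 ?mul1r ?mulr1 ?subrr ?mul0rn ?subr0.
have brP p s : (p <= l)%N -> br (pred_val (ordered_entry M l p) s)
    = pred_val (ordered_entry M l p.-1) s *+ p - ordered_entry M l p s *+ s.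
  move=> hp; case: s => [|s] /=; last exact: IHl.
  by rewrite /br mul0r mulr0 subrr mul0rn mulr0n subr0.
case: (leqP q l) => hql.
  rewrite !ordered_entry0 // ?(leq_trans (leq_pred _)) //.
  rewrite brD !brM !brL !IHl // !brP //= !scale1r !scale0r !sub0r oppr0 mul0r add0r.
  rewrite /= !mulrBr !mulrnAr mulNr.
  move: (M l 1 0 * _) (M l 0 0 * _) (M l 0 0 * _) (M l 1 0 * _) => W X Y Z.
  apply/matrixP => i j; rewrite !(mxE, mulmxnE).
  by ring.
have -> : q = l.+1 by apply/eqP; rewrite eqn_leq hq.
rewrite [in RHS]ordered_entry1 // ordered_entry1 // -[l.+1.-1]/l.
(* One copy will be peeled at a column 0, the other l copies at a column 1; for l = 0 the latter are
   absent, so the value of [l.-1] is harmless. *)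
have -> : ordered_entry M l.+1 l r *+ l.+1
  = ordered_entry M l.+1 l r + ordered_entry M l.+1 l.-1.+1 r *+ l.
  by case: (l) => [|l']; rewrite ?mulrS ?mulr0n.
rewrite ordered_entry0 // ordered_entry1 ?leq_pred //.
rewrite brD !brM !brL !IHl // !brP //= !scale1r !scale0r !subr0 !mulrBr !mulrnAr.
rewrite mulrBl.
move: (M l 0 0 * _) (M l 1 1 * _) (M l 1 0 * _) (M l 0 1 * _) => W X Y Z.
move: (M l 0 1 * _) (M l 1 1 * _) => U V.
apply/matrixP => i j; rewrite !(mxE, mulmxnE).
by ring.
Qed.

Lemma lax_mx_null : fused_null M e.+1.
Proof.
move=> j hj r; elim: r j hj => [|r IHr] j hj.
  by apply/matrixP => a b; rewrite mxE; apply: lax_mx_flag; rewrite hj.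
rewrite (fused_entry_ordered endV_two_reg Mmanin) hj; set q := count_mem _ _.
have hq : (q <= e.+1)%N by rewrite -hj count_size.
have IH p : (p <= e.+1)%N -> ordered_entry M e.+1 p r = 0.
  by move=> hp; apply: IHr; rewrite size_cat !size_nseq subnK.
have := spin_plus_ordered_entry r hq.
rewrite !IH ?(leq_trans (leq_pred _)) // mulr0 mul0r mul0rn subrr sub0r.
move/eqP; rewrite eq_sym oppr_eq0 -scaler_nat scaler_eq0 pnatr_eq0 /=.
by move/eqP.
Qed.

End Vanishing.

End LocalLax.

(** * Classes of functions closed under polynomial operations *)

Section PolynomialFunctions.

Variables (C : numClosedFieldType) (X : Type) (P : (X -> C) -> Prop).

(** The class is abstract because it is used for polynomials in one variable (commutation of
    transfer matrices, the parameter u) and in all of xi and S. *)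
Definition poly_closed : Prop :=
  [/\ forall f g, f =1 g -> P f -> P g,
      forall c, P (fun=> c),
      forall f g, P f -> P g -> P (fun x => f x + g x)
    & forall f g, P f -> P g -> P (fun x => f x * g x)].

Hypothesis PC : poly_closed.

Let Pext f g : f =1 g -> P f -> P g. Proof. by case: PC => h _ _ _; exact: h. Qed.
Let Pcst c : P (fun=> c). Proof. by case: PC. Qed.
Let Padd f g : P f -> P g -> P (fun x => f x + g x).
Proof. by case: PC => _ _ h _; exact: h. Qed.
Let Pmul f g : P f -> P g -> P (fun x => f x * g x).
Proof. by case: PC => _ _ _ h; exact: h. Qed.

Lemma poly_closed_sum (I : Type) (s : seq I) (f : I -> X -> C) :
  (forall i, P (f i)) -> P (fun x => \sum_(i <- s) f i x).
Proof.
move=> h; elim: s => [|i s IHs].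
  by apply: (Pext (f := fun=> 0)) => // x; rewrite big_nil.
by apply: (Pext (f := fun x => f i x + \sum_(j <- s) f j x)) => [x|];
  [rewrite big_cons | exact: Padd].
Qed.

Lemma poly_closed_prod (I : Type) (s : seq I) (Q : pred I) (f : I -> X -> C) :
  (forall i, P (f i)) -> P (fun x => \prod_(i <- s | Q i) f i x).
Proof.
move=> h; elim: s => [|i s IHs].
  by apply: (Pext (f := fun=> 1)) => // x; rewrite big_nil.
case hi: (Q i).
  by apply: (Pext (f := fun x => f i x * \prod_(j <- s | Q j) f j x)) => [x|];
    [rewrite big_cons hi | exact: Pmul].
by apply: Pext IHs => x; rewrite big_cons hi.
Qed.

Lemma poly_closed_opp f : P f -> P (fun x => - f x).
Proof.
move=> h; apply: (Pext (f := fun x => -1 * f x)); first by move=> x; rewrite mulN1r.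
exact: Pmul.
Qed.

Definition mx_poly m n (F : X -> 'M[C]_(m, n)) : Prop :=
  forall i j, P (fun x => F x i j).

Lemma mx_poly_cst m n (A : 'M[C]_(m, n)) : mx_poly (fun=> A).
Proof. by move=> i j; exact: Pcst. Qed.

Lemma mx_poly_add m n (F G : X -> 'M[C]_(m, n)) :
  mx_poly F -> mx_poly G -> mx_poly (fun x => F x + G x).
Proof.
move=> hF hG i j; apply: Pext (Padd (hF i j) (hG i j)) => x.
by rewrite mxE.
Qed.

Lemma mx_poly_scale m n f (F : X -> 'M[C]_(m, n)) :
  P f -> mx_poly F -> mx_poly (fun x => f x *: F x).
Proof.
by move=> hf hF i j; apply: Pext (Pmul hf (hF i j)) => x; rewrite mxE.
Qed.

Lemma mx_poly_sub m n (F G : X -> 'M[C]_(m, n)) :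
  mx_poly F -> mx_poly G -> mx_poly (fun x => F x - G x).
Proof.
move=> hF hG i j; apply: Pext (Padd (hF i j) (poly_closed_opp (hG i j))) => x.
by rewrite !mxE.
Qed.

Lemma mx_poly_mul m n p (F : X -> 'M[C]_(m, n)) (G : X -> 'M[C]_(n, p)) :
  mx_poly F -> mx_poly G -> mx_poly (fun x => F x *m G x).
Proof.
move=> hF hG i j.
apply: (Pext (f := fun x => \sum_k F x i k * G x k j)) => [x|].
  by rewrite mxE.
by apply: poly_closed_sum => k; apply: Pmul.
Qed.

Lemma mx_poly_prod n (I : Type) (s : seq I) (F : I -> X -> 'M[C]_n) :
  (forall i, mx_poly (F i)) -> mx_poly (fun x => \prod_(i <- s) F i x).
Proof.
move=> h; elim: s => [|a s IHs] i j.
  by apply: Pext (mx_poly_cst 1 i j) => x; rewrite big_nil.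
apply: Pext (mx_poly_mul (h a) IHs i j) => x.
by rewrite big_cons.
Qed.

Lemma mx_poly_det n (F : X -> 'M[C]_n) : mx_poly F -> P (fun x => \det (F x)).
Proof.
move=> h; rewrite /determinant; apply: poly_closed_sum => s.
by apply: Pmul; [exact: Pcst | apply: poly_closed_prod => i; exact: h].
Qed.

Lemma mx_poly_on_site p (d : 'I_p -> nat) n (F : X -> 'M[C]_(d n)) :
  mx_poly F -> mx_poly (fun x => on_site (F x)).
Proof.
move=> h i j; case hij: [forall m, (m != n) ==> (mindex i m == mindex j m)].
  by apply: Pext (h (mindex i n) (mindex j n)) => x; rewrite mxE hij.
by apply: Pext (Pcst 0) => x; rewrite mxE hij.
Qed.

End PolynomialFunctions.

Section Univariate.

Variable C : numClosedFieldType.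

Definition poly_fun (f : C -> C) : Prop := exists p : {poly C}, forall x, f x = p.[x].

Lemma poly_fun_closed : poly_closed poly_fun.
Proof.
split=> [f g fg [p hp] | c | f g [p hp] [q hq] | f g [p hp] [q hq]].
- by exists p => x; rewrite -fg.
- by exists c%:P => x; rewrite hornerC.
- by exists (p + q) => x; rewrite hornerD hp hq.
- by exists (p * q) => x; rewrite hornerM hp hq.
Qed.

Lemma poly_fun_id : poly_fun id.
Proof. by exists 'X => x; rewrite hornerX. Qed.

Lemma nonzero_poly_value (p : {poly C}) : p != 0 -> exists x, p.[x] != 0.
Proof.
move=> p0; pose s := [seq i%:R : C | i <- iota 0 (size p)].
have us : uniq s.
  rewrite map_inj_uniq ?iota_uniq // => i j /eqP.
  by rewrite eqr_nat => /eqP.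
case hs: (all (root p) s); last first.
  by move/negbT: hs => /allPn[x _ hx]; exists x.
case/eqP: p0; apply: (roots_geq_poly_eq0 hs us).
by rewrite size_map size_iota.
Qed.

End Univariate.

Section Morphisms.

Variables (A B : pzRingType) (f : A -> B).
Hypothesis f0 : f 0 = 0.
Hypothesis f1 : f 1 = 1.
Hypothesis fD : forall x y, f (x + y) = f x + f y.
Hypothesis fM : forall x y, f (x * y) = f x * f y.

Lemma rtt_map c h t u : rtt c h t u -> rtt (f c) (f h) (map_mx f t) (map_mx f u).
Proof. by move=> r i j k l; rewrite !mxE -!fM -!fD r. Qed.

Lemma qdet_map t u : qdet (map_mx f t) (map_mx f u) = f (qdet t u).
Proof.
have fN x : f (- x) = - f x.
  by apply/eqP; rewrite -addr_eq0 -fD addNr f0.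
by rewrite /qdet !mxE fD fN !fM.
Qed.

Lemma fused_entry_map (M : nat -> 'M[A]_2) j r :
  fused_entry (fun k => map_mx f (M k)) j r = f (fused_entry M j r).
Proof.
elim: j r => [|x j IHj] r /=; first by case: r => [|r] /=; rewrite ?f0 ?f1.
rewrite !mxE fD !fM IHj; congr (_ + _ * _).
by case: r => [|r] /=; rewrite ?f0.
Qed.

End Morphisms.

Section ProductsOverSites.

Variables (A : pzRingType) (I : eqType).
Hypothesis two_reg : forall a : A, a *+ 2 = 0 -> a = 0.

Lemma qdet_prod (F G : I -> 'M[A]_2) (s : seq I) :
  (forall m n, m != n -> ecomm (F m) (G n)) ->
  (forall r : seq I, uniq r -> manin (\prod_(n <- r) F n) (\prod_(n <- r) G n)) ->
  uniq s ->
  qdet (\prod_(n <- s) F n) (\prod_(n <- s) G n)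
  = \prod_(n <- s) qdet (F n) (G n).
Proof.
move=> hFG hm; elim: s => [_ | a s IHs /= /andP[ha hs]].
  by rewrite !big_nil /qdet !mxE /= mulr1 mulr0 subr0.
rewrite !big_cons qdet_mul ?IHs //; last exact: hm.
apply: ecommC; rewrite big_seq; apply: ecomm_prod => n hn; apply: ecommC.
by apply: hFG; apply: contraNneq ha => <-.
Qed.

Lemma fused_null_prod (F : nat -> I -> 'M[A]_2) (s : seq I) (a : I) (l : nat) :
  (forall k k' m n, m != n -> ecomm (F k m) (F k' n)) ->
  (forall k n, manin (F k.+1 n) (F k n)) ->
  uniq s -> a \in s -> fused_null (F ^~ a) l ->
  fused_null (fun k => \prod_(n <- s) F k n) l.
Proof.
move=> hc hm us ha hn; elim: s us ha => //= b s IHs /andP[hb us] ha.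
have hc' k k' : ecomm (F k b) (\prod_(n <- s) F k' n).
  rewrite big_seq; apply: ecomm_prod => n hns; apply: hc.
  by apply: contraNneq hb => ->.
suff h : fused_null (fun k => F k b * \prod_(n <- s) F k n) l.
  move=> j hj r; rewrite -(h j hj r); congr fused_entry.
  by apply/boolp.funext => k; rewrite big_cons.
move: ha; rewrite inE => /orP[/eqP hab | hs].
  by apply: fused_null_mull => //; rewrite -hab.
by apply: fused_null_mulr => //; exact: IHs.
Qed.

End ProductsOverSites.

(** * The monodromy matrix *)

Lemma det_mx22 (R : comPzRingType) (B : 'M[R]_2) :
  \det B = B 0 0 * B 1 1 - B 0 1 * B 1 0.
Proof.
rewrite (expand_det_row _ 0) sum_two /cofactor !det_mx11 !mxE /=.
have -> : lift (0 : 'I_2) (0 : 'I_1) = 1 by exact/val_inj.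
have -> : lift (1 : 'I_2) (0 : 'I_1) = 0 by exact/val_inj.
by rewrite !add0n expr0 expr1 mul1r mulN1r mulrN.
Qed.

Section Chain.

Variables (C : numClosedFieldType) (N : nat) (e : 'I_N -> nat) (K : 'M[C]_2).

Local Notation endH := (endH C e).
Local Notation scal := (fun c : C => c%:M : endH).

Definition site_lax (n : 'I_N) (c b : C) : 'M[endH]_2 :=
  map_mx (on_site (d := site_dim e) (n := n)) (lax_mx (e n) c b).

(** The parameters depend on the site, so that the monodromy matrix and its rescalings are instances
    of one object. *)
Definition twisted_lax (c b : 'I_N -> C) : 'M[endH]_2 :=
  map_mx scal K *
  \prod_(n < N) site_lax (rev_ord n) (c (rev_ord n)) (b (rev_ord n)).

Lemma endH_two_reg (X : endH) : X *+ 2 = 0 -> X = 0.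
Proof. exact: endH_natmul_reg. Qed.

Lemma scal_mul (x y : C) : (x%:M : endH) * y%:M = (x * y)%:M.
Proof. by rewrite scalar_mxM. Qed.

Section SiteMorphism.

Variable n : 'I_N.

Local Notation site := (on_site (d := site_dim e) (n := n) : 'M[C]_((e n).+1) -> endH).

Let site0 : site 0 = 0.
Proof. by rewrite -(scale0r (0 : 'M[C]_((e n).+1))) [site _]on_siteZ scale0r. Qed.

Let site1 : site 1 = 1.
Proof. exact: (on_site_scalar (site_dim e) n 1). Qed.

Let siteD X Y : site (X + Y) = site X + site Y.
Proof. exact: on_siteD. Qed.

Let siteM X Y : site (X * Y) = site X * site Y.
Proof. exact: on_siteM. Qed.

Lemma site_lax_rtt c c' b :
  rtt ((c - c')%:M : endH) (b%:M : endH) (site_lax n c b) (site_lax n c' b).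
Proof.
have := rtt_map siteD siteM (@lax_mx_rtt C (e n) c c' b).
by rewrite /= ![site _](on_site_scalar (site_dim e) n).
Qed.

Lemma qdet_site_lax c b :
  qdet (site_lax n (c + b) b) (site_lax n c b)
  = ((c - half_spin C (e n) * b) * (c + b + half_spin C (e n) * b))%:M.
Proof.
rewrite /site_lax (qdet_map site0 siteD siteM) qdet_lax_mx.
exact: (on_site_scalar (site_dim e) n).
Qed.

Lemma site_lax_null eta : eta != 0 ->
  fused_null (fun k => site_lax n ((k%:R - half_spin C (e n)) * eta) eta) (e n).+1.
Proof.
move=> h j hj r; rewrite /site_lax (fused_entry_map site0 site1 siteD siteM).
by rewrite (lax_mx_null h hj).
Qed.

End SiteMorphism.

Lemma site_lax_comm m n c b c' b' : m != n ->
  ecomm (site_lax m c b) (site_lax n c' b').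
Proof. by move=> hmn i j k l; rewrite !mxE; exact: on_site_comm. Qed.

Lemma scal_ecomm (t : 'M[endH]_2) : ecomm (map_mx scal K) t.
Proof. by move=> i j k l; rewrite mxE scalar_endH_comm. Qed.

Lemma twisted_lax_rtt (c c' b : 'I_N -> C) (x y : C) :
  (forall n, c n - c' n = x) -> (forall n, b n = y) ->
  rtt (x%:M : endH) (y%:M : endH) (twisted_lax c b) (twisted_lax c' b).
Proof.
move=> hc hb; apply: rtt_mul.
- by move=> z; rewrite scalar_endH_comm.
- by move=> z; rewrite scalar_endH_comm.
- by apply: ecommC; exact: scal_ecomm.
- by apply: ecommC => i j k l; rewrite [map_mx _ _ _ _]mxE scalar_endH_comm.
- by move=> i j k l; rewrite !mxE (scalar_endH_comm (K i j)).
apply: rtt_prod; rewrite ?index_enum_uniq //.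
- by move=> z; rewrite scalar_endH_comm.
- by move=> z; rewrite scalar_endH_comm.
- by move=> m n hmn; apply: site_lax_comm; rewrite (inj_eq rev_ord_inj).
by move=> n; rewrite -(hc (rev_ord n)) -(hb (rev_ord n)); exact: site_lax_rtt.
Qed.

End Chain.

Section Monodromy.

Variables (C : numClosedFieldType) (eta : C) (eta0 : eta != 0).
Variables (N : nat) (e : 'I_N -> nat) (xi : 'I_N -> C) (K : 'M[C]_2).

Local Notation endH := (endH C e).
Local Notation scal := (fun c : C => c%:M : endH).
Local Notation M := (monodromy eta e xi K).
Local Notation T := (transfer eta e xi K).
Local Notation fused := (fused_transfer eta e xi K).

Lemma LaxE n lambda : Lax eta e n lambda = site_lax e n (lambda + eta / 2%:R) eta.
Proof.
apply/matrixP => i j; rewrite !mxE.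
case: (ord2_cases i) => ->; case: (ord2_cases j) => -> /=.
- by rewrite mulr1 scalemx1.
- by rewrite mulr0 scale0r add0r.
- by rewrite mulr0 scale0r add0r.
- by rewrite mulr1 scalemx1 scalerN.
Qed.

Lemma monodromyE lambda : M lambda
  = twisted_lax e K (fun n => lambda - xi n + eta / 2%:R) (fun=> eta).
Proof. by rewrite /monodromy; under eq_bigr do rewrite LaxE. Qed.

Lemma monodromy_rtt lambda mu :
  rtt ((lambda - mu)%:M : endH) (eta%:M : endH) (M lambda) (M mu).
Proof.
rewrite !monodromyE; apply: twisted_lax_rtt => // n.
by ring.
Qed.

Lemma eta_endH_reg (x : endH) : (eta%:M : endH) * x = 0 -> x = 0.
Proof.
move=> /eqP; rewrite -mulmxE mul_scalar_mx scaler_eq0 (negbTE eta0) /=.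
by move/eqP.
Qed.

Lemma monodromy_manin lambda k :
  manin (monodromy_at eta e xi K lambda k.+1) (monodromy_at eta e xi K lambda k).
Proof.
apply: (rtt_manin eta_endH_reg).
have := monodromy_rtt (lambda + k.+1%:R * eta) (lambda + k%:R * eta).
have -> // : lambda + k.+1%:R * eta - (lambda + k%:R * eta) = eta.
by rewrite -natr1; ring.
Qed.

Lemma qdet_monodromy lambda k :
  qdet (monodromy_at eta e xi K lambda k.+1) (monodromy_at eta e xi K lambda k)
  = (\det K * a_fun eta e xi (lambda + k.+1%:R * eta)
            * d_fun eta e xi (lambda + k%:R * eta))%:M.
Proof.
have two := @endH_two_reg C N e.
rewrite /monodromy_at !monodromyE /twisted_lax.
pose c1 n := lambda + k.+1%:R * eta - xi n + eta / 2%:R.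
pose c0 n := lambda + k%:R * eta - xi n + eta / 2%:R.
have c10 n : c1 n = c0 n + eta by rewrite /c1 /c0 -natr1; ring.
have man r : uniq r -> manin
   (\prod_(n <- r) site_lax e (rev_ord n) (c1 (rev_ord n)) eta)
   (\prod_(n <- r) site_lax e (rev_ord n) (c0 (rev_ord n)) eta).
  move=> ur; apply: (rtt_manin eta_endH_reg); apply: rtt_prod => //.
  - by move=> z; rewrite scalar_endH_comm.
  - by move=> z; rewrite scalar_endH_comm.
  - by move=> m n hmn; apply: site_lax_comm; rewrite (inj_eq rev_ord_inj).
  move=> n; have := @site_lax_rtt C N e (rev_ord n) (c1 (rev_ord n)) (c0 (rev_ord n)) eta.
  by rewrite c10 [_ + eta]addrC addrK.
rewrite qdet_mul //; first last.
- exact: man (index_enum_uniq _).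
- by apply: ecommC; exact: scal_ecomm.
  rewrite qdet_prod ?index_enum_uniq //; last first.
    by move=> m n hmn; apply: site_lax_comm; rewrite (inj_eq rev_ord_inj).
  have -> : qdet (map_mx scal K) (map_mx scal K) = (\det K)%:M.
    rewrite /qdet !mxE !scal_mul -raddfB det_mx22 /=.
    by rewrite mulrC [K 1 0 * _]mulrC.
  rewrite (eq_bigr (fun n => ((c0 (rev_ord n) - half_spin C (e (rev_ord n)) * eta)
    * (c0 (rev_ord n) + eta + half_spin C (e (rev_ord n)) * eta))%:M : endH)); last first.
    by move=> n _; rewrite -qdet_site_lax -c10.
  rewrite -(rmorph_prod (@scalar_mx C (hdim e))) scal_mul -mulrA -big_split.
  congr ((_ * _)%:M); rewrite [RHS](reindex_inj rev_ord_inj) /=.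
  apply: eq_bigr => n _; rewrite /c0 /xi_shift -natr1 /half_spin.
  have h2 : 2%:R != 0 :> C by rewrite pnatr_eq0.
  by field.
Qed.

Lemma fused_transferE lambda l :
  fused l lambda = fused_trace (monodromy_at eta e xi K lambda) l.
Proof. by apply: fused_transfer_trace => k; exact: monodromy_manin. Qed.

Lemma fused_transfer0 lambda : fused 0 lambda = 1.
Proof. by []. Qed.

Lemma fused_transfer1 lambda : fused 1 lambda = T lambda.
Proof.
rewrite fused_transferE (fused_trace1 (@endH_two_reg C N e)).
  by rewrite /monodromy_at mul0r addr0.
by move=> k; exact: monodromy_manin.
Qed.

Lemma fused_transfer_fusion lambda l :
  fused l.+2 lambda = T (lambda + l.+1%:R * eta) * fused l.+1 lambda
    - (\det K * a_fun eta e xi (lambda + l.+1%:R * eta)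
              * d_fun eta e xi (lambda + l%:R * eta)) *: fused l lambda.
Proof.
rewrite !fused_transferE (fusion_recursion (@endH_two_reg C N e)); last first.
  by move=> k; exact: monodromy_manin.
by rewrite qdet_monodromy -mulmxE mul_scalar_mx.
Qed.

Lemma fused_transfer_vanish n :
  fused (e n).+1 (xi_shift eta e xi n (e n)) = 0.
Proof.
rewrite fused_transferE; apply: fused_trace_null.
set lambda := xi_shift _ _ _ _ _.
pose F k m := site_lax e (rev_ord m)
  (lambda + k%:R * eta - xi (rev_ord m) + eta / 2%:R) eta.
suff h : fused_null (fun k => map_mx scal K * \prod_(m < N) F k m) (e n).+1.
  move=> j hj r; rewrite -(h j hj r); congr fused_entry.
  by apply/boolp.funext => k; rewrite /monodromy_at monodromyE.
have two := @endH_two_reg C N e.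
apply: fused_null_mulr.
- exact: two.
- move=> k i p j q; rewrite !mxE (scalar_endH_comm (K i j)).
  by rewrite (scalar_endH_comm (K p j)) addrC.
- by move=> k k'; exact: scal_ecomm.
apply: (@fused_null_prod _ _ two F _ (rev_ord n)).
- by move=> k k' m m' hm; apply: site_lax_comm; rewrite (inj_eq rev_ord_inj).
- move=> k m; apply: (rtt_manin eta_endH_reg).
  pose c := lambda + k%:R * eta - xi (rev_ord m) + eta / 2%:R.
  have -> : F k.+1 m = site_lax e (rev_ord m) (c + eta) eta.
    by congr site_lax; rewrite /c -natr1; ring.
  have := @site_lax_rtt C N e (rev_ord m) (c + eta) c eta.
  by rewrite [c + eta]addrC addrK.
- exact: index_enum_uniq.
- exact: mem_index_enum.
(* At site n the parameter lambda + k eta - xi_n + eta/2 equals (k - s_n) eta, the string on which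
   the local fused Lax operator vanishes. *)
rewrite /F rev_ordK => j hj r; rewrite -(@site_lax_null C N e n eta eta0 j hj r).
congr fused_entry; apply/boolp.funext => k; congr site_lax.
rewrite /lambda /xi_shift /half_spin.
have h2 : 2%:R != 0 :> C by rewrite pnatr_eq0.
by field.
Qed.

Lemma twisted_lax_poly X (P : (X -> C) -> Prop) (c b : X -> 'I_N -> C) :
  poly_closed P ->
  (forall n, P (fun x => c x n)) -> (forall n, P (fun x => b x n)) ->
  forall i j, mx_poly P (fun x => twisted_lax e K (c x) (b x) i j).
Proof.
move=> hP hc hb.
have [hext hcst _ _] := hP.
have hmul (F G : X -> 'M[endH]_2) :
    (forall i j, mx_poly P (fun x => F x i j)) ->
    (forall i j, mx_poly P (fun x => G x i j)) ->
    forall i j, mx_poly P (fun x => (F x * G x) i j).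
  move=> hF hG i j p q.
  apply: (hext (fun x => \sum_k (F x i k *m G x k j) p q)).
    by move=> x; rewrite -mulmxE mxE summxE.
  apply: (poly_closed_sum hP) => k; exact: (mx_poly_mul hP (hF i k) (hG k j)).
apply: (hmul _ _) => [i j p q|].
  apply: hext (hcst ((map_mx scal K : 'M[endH]_2) i j p q)) => x //.
elim: (index_enum _) => [|n s IHs] i j p q.
  by apply: hext (hcst ((1 : 'M[endH]_2) i j p q)) => x; rewrite big_nil.
apply: (hext) (hmul _ _ _ IHs i j p q) => [x|].
  by rewrite big_cons.
move=> {i j p q} i j p q.
apply: (hext (fun x => (on_site (d := site_dim e) (n := rev_ord n)
   (lax_mx (e (rev_ord n)) (c x (rev_ord n)) (b x (rev_ord n)) i j)) p q)).
  move=> x; congr (fun_of_matrix _ p q).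
  by rewrite /site_lax [RHS]mxE.
apply: (mx_poly_on_site hP) => {p q} p q.
apply: (hext (fun x => (c x (rev_ord n) *: ((i == j)%:R *: 1%:M)
  + b x (rev_ord n) *: sl2_mx C (e (rev_ord n)) i j) p q)).
  by move=> x; rewrite lax_mxE scalerA.
apply: (mx_poly_add hP); apply: (mx_poly_scale hP) => //; exact: (mx_poly_cst hP).
Qed.

Lemma twisted_trace_poly X (P : (X -> C) -> Prop) (c b : X -> 'I_N -> C) :
  poly_closed P ->
  (forall n, P (fun x => c x n)) -> (forall n, P (fun x => b x n)) ->
  mx_poly P (fun x => \tr (twisted_lax e K (c x) (b x)) : endH).
Proof.
move=> hP hc hb p q; have [hext _ hadd _] := hP.
apply: (hext (fun x => twisted_lax e K (c x) (b x) 0 0 p q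
                     + twisted_lax e K (c x) (b x) 1 1 p q)).
  by move=> x; rewrite /mxtrace sum_two [RHS]mxE.
by apply: hadd; apply: twisted_lax_poly.
Qed.

(* The exchange relation gives the commutation away from lambda - mu = 0 or
   +-eta; the exceptions are removed by polynomiality in lambda. *)
Lemma transfer_comm lambda mu : T lambda * T mu = T mu * T lambda.
Proof.
have hP := poly_fun_closed C; have [_ hcst hadd hmul] := hP.
have Tpoly : mx_poly (@poly_fun C) T.
  move=> p q; have := twisted_trace_poly hP (c := fun x n => x - xi n + eta / 2%:R)
    (b := fun _ _ => eta) _ _ p q.
  have -> : (fun x => (\tr (twisted_lax e K (fun n => x - xi n + eta / 2%:R)
                                 (fun=> eta)) : endH) p q)
     = (fun x => T x p q) by apply/boolp.funext => x; rewrite -monodromyE.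
  apply => n; last exact: hcst.
  apply: (hadd (fun x => x - xi n)); last exact: hcst.
  by apply: (hadd id (fun=> - xi n)); [exact: poly_fun_id | exact: hcst].
apply/eqP; rewrite -subr_eq0; apply/eqP/matrixP => p q; rewrite [RHS]mxE.
have [f hf] : poly_fun (fun x => (T x *m T mu - T mu *m T x) p q).
  by apply: (mx_poly_sub hP); apply: (mx_poly_mul hP) => //; exact: (mx_poly_cst hP).
rewrite -[LHS]/((T lambda *m T mu - T mu *m T lambda) p q) hf.
(* This product vanishes at every point, hence as a polynomial; its second factor takes the nonzero
   value - eta^2 at mu, so f = 0. *)
suff : f * (('X - mu%:P) ^+ 2 - (eta ^+ 2)%:P) == 0.
  rewrite mulf_eq0 => /orP[/eqP -> | h0]; first by rewrite horner0.
  have := congr1 (fun g : {poly C} => g.[mu]) (eqP h0).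
  rewrite !hornerE subrr expr0n /= sub0r => /eqP.
  by rewrite oppr_eq0 expf_eq0 (negbTE eta0) andbF.
apply/eqP; apply: contraTeq isT => /nonzero_poly_value[x] /negP; case.
rewrite hornerM -hf !hornerE.
have := rtt_trace _ _ (monodromy_rtt x mu).
move/(_ (scalar_endH_comm _))/(_ (scalar_endH_comm _)).
rewrite !scal_mul -raddfB /= => /matrixP/(_ p q).
rewrite -mulmxE mul_scalar_mx [LHS]mxE [RHS]mxE => h.
by rewrite mulrC !expr2 -h eqxx.
Qed.

Lemma fused_transfer_comm lambda mu l :
  fused l lambda * T mu = T mu * fused l lambda.
Proof.
suff : fused l lambda * T mu = T mu * fused l lambda /\
   fused l.+1 lambda * T mu = T mu * fused l.+1 lambda by case.
elim: l => [|l [IH0 IH1]].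
  rewrite fused_transfer0 fused_transfer1 mulr1 mul1r.
  by split => //; exact: transfer_comm.
split=> //; rewrite fused_transfer_fusion mulrBl mulrBr -!mulmxE -scalemxAl -scalemxAr.
rewrite !mulmxE IH0; congr (_ - _).
by rewrite -mulrA IH1 !mulrA transfer_comm.
Qed.

End Monodromy.

(** * The separate action *)

(** T commutes with every factor, so it can be moved next to the n-th one, where its action is
    known. *)
Lemma prod_mul_site (C : numClosedFieldType) (d : nat) (I : eqType) (s : seq I)
    (G : I -> 'M[C]_d) (T A B : 'M[C]_d) (alpha beta : C) (n : I) :
  (forall m, G m * T = T * G m) -> G n * T = alpha *: A + beta *: B ->
  uniq s -> n \in s ->
  (\prod_(m <- s) G m) *m T
  = alpha *: \prod_(m <- s) (if m == n then A else G m)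
    + beta *: \prod_(m <- s) (if m == n then B else G m).
Proof.
rewrite mulmxE => hT hn; elim: s => //= a s IHs /andP[ha us]; rewrite inE.
have comm : (\prod_(m <- s) G m) * T = T * \prod_(m <- s) G m.
  by elim/big_rec: _ => [|i y _ IH]; rewrite ?mulr1 ?mul1r // -mulrA IH !mulrA hT.
case: (eqVneq n a) => [na _ | na /= hns].
  have eqG Z : \prod_(m <- s) (if m == n then Z else G m) = \prod_(m <- s) G m.
    rewrite big_seq [RHS]big_seq; apply: eq_bigr => m hm.
    by case: eqVneq => // mn; rewrite mn na (negbTE ha) in hm.
  rewrite !big_cons !eqG -na eqxx -mulrA comm mulrA hn mulrDl.
  by rewrite -!mulmxE -!scalemxAl.
rewrite !big_cons eq_sym (negbTE na) -mulrA IHs // mulrDr.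
by rewrite -!mulmxE -!scalemxAr.
Qed.

Section SeparateAction.

Variables (C : numClosedFieldType) (eta : C) (eta0 : eta != 0).
Variables (N : nat) (e : 'I_N -> nat) (xi : 'I_N -> C) (K : 'M[C]_2).
Variables (k1 k2 : C) (S : 'rV[C]_(hdim e)).
Hypothesis detK : \det K = k1 * k2.
Hypothesis k20 : k2 != 0.

Local Notation endH := (endH C e).
Local Notation T := (transfer eta e xi K).
Local Notation d := (d_fun eta e xi).
Local Notation a := (a_fun eta e xi).
Local Notation pt := (xi_shift eta e xi).

(** Indexed by l = 2s_n - h_n: raising h_n lowers the fusion level. *)
Definition sov_factor (n : 'I_N) (l : nat) : endH :=
  (k2 ^- l / \prod_(k < l) d (pt n (e n - k)))
  *: fused_transfer eta e xi K l (pt n (e n)).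

Lemma pt_top n l : (l <= e n)%N -> pt n (e n) + l%:R * eta = pt n (e n - l).
Proof. by move=> hl; rewrite /xi_shift natrB //; ring. Qed.

Lemma a_fun_top n : a (pt n (e n)) = 0.
Proof. by rewrite /a_fun (bigD1 n) //= subrr mul0r. Qed.

Lemma d_fun_bottom n : d (pt n 0) = 0.
Proof. by rewrite /d_fun (bigD1 n) //= subrr mul0r. Qed.

Hypothesis d0 : forall n k, (0 < k <= e n)%N -> d (pt n k) != 0.

Let dprod0 n l : (l <= e n)%N -> \prod_(k < l) d (pt n (e n - k)) != 0.
Proof.
move=> hl; apply/prodf_neq0 => k _; apply: d0; rewrite leq_subr andbT subn_gt0.
exact: leq_trans hl.
Qed.

Lemma sov_factor_action n l : (l <= e n)%N ->
  let x := pt n (e n - l) in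
  sov_factor n l * T x
  = (k1 * a x) *: (if l is l'.+1 then sov_factor n l' else 0)
    + (k2 * d x) *: (if (l < e n)%N then sov_factor n l.+1 else 0).
Proof.
move=> hl x; rewrite /sov_factor -mulmxE -scalemxAl mulmxE.
rewrite (fused_transfer_comm eta0).
have up : (k2 ^- l / \prod_(k < l) d (pt n (e n - k)))
      *: fused_transfer eta e xi K l.+1 (pt n (e n))
    = (k2 * d x) *: (if (l < e n)%N then sov_factor n l.+1 else 0).
  case: ltnP => hle.
    rewrite /sov_factor scalerA big_ord_recr /= -/x; congr (_ *: _).
    have hd := dprod0 hl; have hx : d x != 0.
      by apply: d0; rewrite subn_gt0 hle leq_subr.
    by rewrite exprS; field; rewrite hd hx k20 expf_neq0.
  (* This is h_n = 0: the next fused transfer matrix vanishes, which closes the recursion. *)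
  have -> : l = e n by apply/eqP; rewrite eqn_leq hl.
  by rewrite fused_transfer_vanish // !scaler0.
have tx : x = pt n (e n) + l%:R * eta by rewrite pt_top.
(* For l = 0, that is h_n = 2s_n, the transfer matrix is itself the first fused one and there is no
   lower level. *)
case: l hl @x up tx => [|l] hl x up tx.
  rewrite scaler0 add0r -up fused_transfer1 // fused_transfer0 mulr1 -/x tx.
  by rewrite mul0r addr0.
have -> : T x * fused_transfer eta e xi K l.+1 (pt n (e n))
  = fused_transfer eta e xi K l.+2 (pt n (e n))
    + (k1 * k2 * a x * d (pt n (e n - l)))
      *: fused_transfer eta e xi K l (pt n (e n)).
  by rewrite fused_transfer_fusion // -tx detK pt_top ?addrNK // ltnW.
rewrite scalerDr up addrC; congr (_ + _); rewrite /sov_factor !scalerA.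
congr (_ *: _); rewrite big_ord_recr /=.
have hd := dprod0 (ltnW hl); have hx : d (pt n (e n - l)) != 0.
  by apply: d0; rewrite subn_gt0 hl leq_subr.
by rewrite exprS; field; rewrite hd hx k20 expf_neq0.
Qed.

Lemma sov_covectorE h : sov_covector eta xi K k2 S h
  = S *m \prod_(n < N) sov_factor n (e n - h n).
Proof. by []. Qed.

Lemma sov_covector_ext_in (g : tidx (site_dim e)) (h : 'I_N -> int) :
  (forall n, (g n)%:Z = h n) ->
  sov_covector_ext eta xi K k2 S h = sov_covector eta xi K k2 S g.
Proof.
move=> hg; rewrite /sov_covector_ext; case: pickP => [f /forallP hf | /(_ g)].
  congr (sov_covector _ _ _ _ _ _); apply/ffunP => n; apply/val_inj.
  by have := hf n; rewrite -hg => /eqP[].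
by move/negP; case; apply/forallP => n; rewrite hg.
Qed.

Lemma sov_covector_transfer n (h : tidx (site_dim e)) :
  let x := pt n (h n) in
  sov_covector eta xi K k2 S h *m T x
  = (k1 * a x) *: sov_covector_ext eta xi K k2 S (fun m => (h m)%:Z + (m == n)%:Z)
    + (k2 * d x) *: sov_covector_ext eta xi K k2 S (fun m => (h m)%:Z - (m == n)%:Z).
Proof.
move=> x; have hle m : (h m <= e m)%N by rewrite -ltnS.
have hx : x = pt n (e n - (e n - h n)) by rewrite subKn.
rewrite sov_covectorE -mulmxA.
have act := sov_factor_action (leq_subr (h n) (e n)); rewrite /= -hx in act.
have hT m : sov_factor m (e m - h m) * T x = T x * sov_factor m (e m - h m).
  by rewrite /sov_factor -!mulmxE -scalemxAl -scalemxAr mulmxE fused_transfer_comm.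
rewrite (prod_mul_site hT act (index_enum_uniq _) (mem_index_enum _)).
rewrite mulmxDr -!scalemxAr; congr (_ + _).
    case: (ltnP (h n) (e n)) => hn; last first.
      (* The raised index is out of range, and its coefficient is zero. *)
      have -> : x = pt n (e n) by congr pt; apply/eqP; rewrite eqn_leq hle.
      by rewrite a_fun_top mulr0 !scale0r.
    pose g : tidx (site_dim e) :=
      finfun (fun m => inord (h m + (m == n)) : 'I_(site_dim e m)).
    have gE m : g m = (h m + (m == n))%N :> nat.
      rewrite ffunE inordK // ltnS; case: eqVneq => [->|_]; rewrite ?addn0 //.
      by rewrite addn1.
    rewrite (@sov_covector_ext_in g) => [|m]; last by rewrite gE PoszD.
    rewrite sov_covectorE; congr (_ *: (_ *m _)); apply: eq_bigr => m _.
    rewrite gE; case: eqVneq => [->|_]; last by rewrite addn0.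
    by move: hn; rewrite -subn_gt0 addn1 subnS; case: (e n - h n)%N.
  have [hn | hn] := posnP (h n).
    by rewrite /x hn d_fun_bottom mulr0 !scale0r.
  pose g : tidx (site_dim e) :=
      finfun (fun m => inord (h m - (m == n)) : 'I_(site_dim e m)).
  have gE m : g m = (h m - (m == n))%N :> nat.
    by rewrite ffunE inordK // ltnS; exact: leq_trans (leq_subr _ _) _.
  rewrite (@sov_covector_ext_in g) => [|m]; last first.
    by rewrite gE subzn //; case: eqVneq => // ->.
  rewrite sov_covectorE; congr (_ *: (_ *m _)); apply: eq_bigr => m _.
  rewrite gE; case: eqVneq => [->|_]; last by rewrite subn0.
  have he : (0 < e n)%N by exact: leq_trans hn (hle n).
  by rewrite ltn_subrL hn he /= subnBA // addn1 subSn.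
Qed.

End SeparateAction.

Section BasisNonzero.

Variables (C : numClosedFieldType) (eta : C).
Variables (N : nat) (e : 'I_N -> nat) (xi : 'I_N -> C) (K : 'M[C]_2).
Variables (k2 : C) (S : 'rV[C]_(hdim e)).

(** The covector with all h_n = 0 has every such value of d in its denominators; if one were zero,
    that covector would be zero, against freeness. *)
Lemma sov_basis_d_fun n k : sov_basis eta xi K k2 S -> (0 < k <= e n)%N ->
  d_fun eta e xi (xi_shift eta e xi n k) != 0.
Proof.
move=> /andP[_ hfree] /andP[k0 hk]; apply/negP => /eqP hd.
pose h : tidx (site_dim e) := finfun (fun m => ord0 : 'I_(site_dim e m)).
have : sov_covector eta xi K k2 S h != 0.
  by rewrite (free_not0 hfree) // image_f.
case/eqP; rewrite sov_covectorE.
suff -> : \prod_(m < N) sov_factor eta e xi K k2 m (e m - h m) = 0 by rewrite mulmx0.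
elim: (index_enum _) (mem_index_enum n) => // m s IHs; rewrite inE big_cons.
case/orP => [/eqP <- | /IHs ->]; last by rewrite mulr0.
rewrite /sov_factor ffunE subn0 (_ : \prod_(i < e n) _ = 0).
  by rewrite invr0 mulr0 scale0r mul0r.
(* The factor number 2s_n - k of the denominator is the value of d at xi_n^{(k)}. *)
have hk' : (e n - k < e n)%N by rewrite ltn_subrL k0 (leq_trans k0 hk).
by rewrite (bigD1 (Ordinal hk')) //= subKn // hd mul0r.
Qed.

End BasisNonzero.

(** * Genericity of the basis *)

Lemma prod_sum_dffun (R : comPzRingType) (p : nat) (d : 'I_p -> nat)
    (F : forall n, 'I_(d n) -> R) :
  \sum_(f : tidx d) \prod_n F n (f n) = \prod_n \sum_x F n x.
Proof.
pose T_ n : finType := 'I_(d n).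
pose P n : {ffun T_ n -> R} := [ffun x => F n x].
rewrite (reindex (@dffun_of_fprod _ T_)); last first.
  exact: onW_bij (dffun_of_fprod_bij _).
transitivity (\sum_(t : fprod T_) \prod_(n in 'I_p) P n (t n)).
  by apply: eq_bigr => t _; apply: eq_bigr => n _; rewrite !ffunE.
rewrite big_fprod.
transitivity (\prod_n \sum_(j in tagged_with T_ n) untag 0 (P n) j).
  by rewrite bigA_distr_big_dep.
apply: eq_bigr => n _.
transitivity (\sum_x P n x); last by apply: eq_bigr => x _; rewrite ffunE.
exact: (esym (@big_tag R 0 _ _ T_ (fun m => P m : _ -> R) n)).
Qed.

(** * Cyclic covectors for elements of sl_2 *)

Section Krylov.

Variables (C : numClosedFieldType) (e : nat).

Definition krylov (s : 'rV[C]_e.+1) (X : 'M[C]_e.+1) : 'M[C]_e.+1 :=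
  \matrix_(k, j) (s *m X ^+ k) 0 j.

Lemma trig_unitmx n (B : 'M[C]_n) :
  (forall i j : 'I_n, (i < j)%N -> B i j = 0) -> (forall i, B i i != 0) ->
  B \in unitmx.
Proof.
move=> h0 h1; rewrite unitmxE det_trig; last exact/is_trig_mxP.
by rewrite unitfE; apply/prodf_neq0 => i _.
Qed.

(** With a nonzero superdiagonal and nothing above it, the k-th iterate of the first basis covector
    ends exactly at coordinate k, so the Krylov matrix is triangular. *)
Lemma krylov_upper (X : 'M[C]_e.+1) :
  (forall i j : 'I_e.+1, (i.+1 < j)%N -> X i j = 0) ->
  (forall i j : 'I_e.+1, j = i.+1 :> nat -> X i j != 0) ->
  krylov (delta_mx 0 0) X \in unitmx.
Proof.
move=> h0 h1.
have H k :
  (forall j : 'I_e.+1, (k < j)%N -> ((delta_mx 0 0 : 'rV_e.+1) *m X ^+ k) 0 j = 0)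
  /\ (forall j : 'I_e.+1, k = j -> ((delta_mx 0 0 : 'rV_e.+1) *m X ^+ k) 0 j != 0).
  elim: k => [|k [IH0 IH1]].
    rewrite expr0 mulmx1; split=> j; rewrite mxE /=.
      by case: (eqVneq j 0) => // ->.
    move=> j0; have -> : j = 0 by exact/val_inj.
    by rewrite !eqxx oner_neq0.
  rewrite exprSr -mulmxE mulmxA; split=> j hj.
    rewrite mxE big1 // => m _; case: (ltnP k m) => hm; first by rewrite IH0 ?mul0r.
    by rewrite h0 ?mulr0 //; exact: leq_ltn_trans hj.
  have hk : (k < e.+1)%N by apply: ltnW; rewrite hj.
  rewrite mxE (bigD1 (Ordinal hk)) //= big1 ?addr0.
    by rewrite mulf_neq0 ?IH1 // h1.
  move=> m hm; case: (ltnP k m) => hkm; first by rewrite IH0 ?mul0r.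
  rewrite h0 ?mulr0 // -hj ltnS ltn_neqAle hkm andbT.
  by apply: contraNneq hm => hm; apply/eqP/val_inj.
by apply: trig_unitmx => [i j | i]; rewrite mxE; case: (H i) => ? ?; auto.
Qed.

Lemma krylov_perm (s : 'rV[C]_e.+1) (X : 'M[C]_e.+1) (t : 'S_e.+1) :
  krylov s (perm_mx t *m X *m (perm_mx t)^T) \in unitmx ->
  krylov (s *m perm_mx t) X \in unitmx.
Proof.
have tK : perm_mx t *m (perm_mx t)^T = 1%:M :> 'M[C]_e.+1.
  by rewrite tr_perm_mx -perm_mxM mulgV perm_mx1.
have tK' : (perm_mx t)^T *m perm_mx t = 1%:M :> 'M[C]_e.+1.
  by rewrite tr_perm_mx -perm_mxM mulVg perm_mx1.
have -> : krylov s (perm_mx t *m X *m (perm_mx t)^T)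
   = krylov (s *m perm_mx t) X *m (perm_mx t)^T.
  have E k : (perm_mx t *m X *m (perm_mx t)^T) ^+ k
      = perm_mx t *m X ^+ k *m (perm_mx t)^T.
    elim: k => [|k IHk]; first by rewrite !expr0 mulmx1 tK.
    by rewrite !exprS IHk -!mulmxE !mulmxA -(mulmxA _ _ (perm_mx t)) tK' mulmx1.
  apply/row_matrixP => k; rewrite row_mul.
  have rk (v : 'rV[C]_e.+1) Y : row k (krylov v Y) = v *m Y ^+ k.
    by apply/rowP => j; rewrite !mxE.
  by rewrite !rk E !mulmxA.
by rewrite unitmx_mul => /andP[].
Qed.

Lemma krylov_diag (z : 'I_e.+1 -> C) : injective z ->
  krylov (const_mx 1) (diag_mx (\row_j z j)) \in unitmx.
Proof.
move=> hz; have -> : krylov (const_mx 1) (diag_mx (\row_j z j))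
   = Vandermonde e.+1 (\row_j z j).
  have E k : (const_mx 1 : 'rV[C]_e.+1) *m diag_mx (\row_j z j) ^+ k = \row_j z j ^+ k.
    elim: k => [|k IHk]; first by apply/rowP => j; rewrite mulmx1 !mxE expr0.
    rewrite exprSr -mulmxE mulmxA IHk; apply/rowP => j.
    by rewrite mul_mx_diag !mxE exprSr.
  by apply/matrixP => k j; rewrite [LHS]mxE E !mxE.
rewrite unitmxE det_Vandermonde unitfE; apply/prodf_neq0 => i _.
apply/prodf_neq0 => j hij; rewrite !mxE subr_eq0 (inj_eq hz).
by apply: contraTneq hij => ->; rewrite ltnn.
Qed.

(** A cyclic covector in three cases: the first basis covector if y is nonzero; the last one, by
    reversing the basis, if y = 0 and z is nonzero; the all-ones covector if X is diagonal with
    distinct entries, by Vandermonde. *)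
Lemma sl2_cyclic (x y z : C) : [|| x != 0, y != 0 | z != 0] ->
  exists s, krylov s (x *: spin_z C e + y *: spin_plus C e + z *: spin_minus C e)
    \in unitmx.
Proof.
set X := _ + _ + _ => h.
have Sp0 (i j : 'I_e.+1) : j != i.+1 :> nat -> spin_plus C e i j = 0.
  by move=> hij; rewrite spin_plusE (negbTE hij).
have Sp1 (i j : 'I_e.+1) : j = i.+1 :> nat -> spin_plus C e i j != 0.
  move=> hij; rewrite spin_plusE hij eqxx sqrtC_eq0 pnatr_eq0 muln_eq0 /=.
  by rewrite subn_eq0 -ltnNge -ltnS -hij ltn_ord.
have XE (i j : 'I_e.+1) : X i j = x * ((half_spin C e - i%:R) *+ (i == j))
    + y * spin_plus C e i j + z * spin_plus C e j i.
  by rewrite !mxE; case: (i == j).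
have [y0 | y0] := eqVneq y 0; last first.
  exists (delta_mx 0 0); apply: krylov_upper => i j hij; rewrite XE.
    rewrite (Sp0 i j) ?(Sp0 j i) ?mulr0 ?addr0; first last.
    - by apply: contraTneq hij => ->; rewrite ltnn.
    - by apply: contraTneq hij => ->; rewrite -ltnNge ltnS leqW // leqW.
    case: (eqVneq i j) hij => [->|_]; last by rewrite mulr0n mulr0.
    by rewrite ltnNge leqnSn.
  rewrite (Sp0 j i) ?mulr0 ?addr0; last first.
    by rewrite hij ltn_eqF // ltnS leqnSn.
  case: (eqVneq i j) hij => [->|_] hij; first by have := ltnn j; rewrite {2}hij ltnSn.
  by rewrite mulr0n mulr0 add0r mulf_neq0 // Sp1.
have [z0 | z0] := eqVneq z 0; last first.
  pose t : 'S_e.+1 := perm rev_ord_inj.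
  exists (delta_mx 0 0 *m perm_mx t); apply: krylov_perm.
  have XtE i j : (perm_mx t *m X *m (perm_mx t)^T) i j = X (rev_ord i) (rev_ord j).
    by rewrite tr_perm_mx -col_permE -row_permE [LHS]mxE [LHS]mxE !permE.
  apply: krylov_upper => i j hij; rewrite XtE XE y0 mul0r addr0.
    rewrite Sp0 ?mulr0 ?addr0; last first.
      apply: contraTneq hij => hji; rewrite -ltnNge ltnS.
      have {hji} : (e.+1 - i.+1 = (e.+1 - j.+1).+1)%N := hji.
      by have := ltn_ord i; have := ltn_ord j; lia.
    case: eqP => [/rev_ord_inj ij|_]; last by rewrite mulr0n mulr0.
    by move: hij; rewrite ij ltnNge leqnSn.
  have hj := ltn_ord j; have ji : rev_ord i = (rev_ord j).+1 :> nat by rewrite /=; lia.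
  rewrite (inj_eq rev_ord_inj) -(inj_eq val_inj) /= hij ltn_eqF // mulr0n mulr0 add0r.
  by rewrite mulf_neq0 // Sp1.
exists (const_mx 1).
have -> : X = diag_mx (\row_j (x * (half_spin C e - j%:R))).
  apply/matrixP => i j; rewrite XE y0 z0 !mul0r !addr0 !mxE.
  by case: (eqVneq i j) => [->|]; rewrite ?mulr0n ?mulr0.
apply: krylov_diag => i j /(mulfI _) hij; apply/val_inj/eqP.
have x0 : x != 0 by move: h; rewrite y0 z0 eqxx /= orbF.
have := hij x0 => /(addrI _)/oppr_inj/eqP.
by rewrite eqr_nat.
Qed.

End Krylov.

Lemma nat_ind2 (P : nat -> Prop) : P 0%N -> P 1%N ->
  (forall l, P l -> P l.+1 -> P l.+2) -> forall l, P l.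
Proof.
move=> h0 h1 h l; suff : P l /\ P l.+1 by case.
by elim: l => [|l [? ?]]; split; auto.
Qed.

Section FusionRecursion.

Variable C : numClosedFieldType.

(** The recursion that builds the fused transfer matrices from values t of the transfer matrix and q
    of the quantum determinant; it still makes sense at u = 0, where no chain is behind it. *)
Fixpoint fusion_rec n (t : nat -> 'M[C]_n) (q : nat -> C) (l : nat) : 'M[C]_n :=
  match l with
  | 0 => 1%:M
  | 1 => t 0%N
  | (l2.+1 as l1).+1 => t l1 *m fusion_rec t q l1 - q l2 *: fusion_rec t q l2
  end.

Lemma eq_fusion_rec n (t t' : nat -> 'M[C]_n) (q q' : nat -> C) :
  t =1 t' -> q =1 q' -> fusion_rec t q =1 fusion_rec t' q'.
Proof.
move=> ht hq; apply: nat_ind2 => [||l h0 h1]; [by [] | exact: ht |].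
exact: (congr2 (fun x y => x - y) (congr2 mulmx (ht _) h1) (congr2 *:%R (hq _) h0)).
Qed.

(** The recursion is homogeneous of degree l if t has weight 1 and q weight 2; this is how powers of
    u are cleared. *)
Lemma fusion_rec_scale n (t : nat -> 'M[C]_n) q (r : C) l :
  fusion_rec (fun k => r *: t k) (fun k => r ^+ 2 * q k) l
  = r ^+ l *: fusion_rec t q l.
Proof.
elim/nat_ind2: l => [||l h0 h1]; rewrite ?scale1r //.
have E t' q' : fusion_rec t' q' l.+2
  = t' l.+1 *m fusion_rec t' q' l.+1 - q' l *: fusion_rec t' q' l :> 'M_n by [].
rewrite !E h0 h1 -scalemxAl -scalemxAr !scalerA scalerBr !scalerA -exprS.
by congr (_ - _ *: _); rewrite !exprS expr0; ring.
Qed.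

Lemma fusion_rec_poly X (P : (X -> C) -> Prop) n (t : X -> nat -> 'M[C]_n)
    (q : X -> nat -> C) l : poly_closed P ->
  (forall k, mx_poly P (fun x => t x k)) -> (forall k, P (fun x => q x k)) ->
  mx_poly P (fun x => fusion_rec (t x) (q x) l).
Proof.
move=> hP ht hq; elim/nat_ind2: l => [||l h0 h1].
- exact: (mx_poly_cst hP).
- exact: ht.
exact: (mx_poly_sub hP (mx_poly_mul hP (ht l.+1) h1) (mx_poly_scale hP (hq l) h0)).
Qed.

Lemma fusion_rec_on_site p (d : 'I_p -> nat) n (t : nat -> 'M[C]_(d n)) q l :
  fusion_rec (fun k => on_site (t k)) q l = on_site (fusion_rec t q l).
Proof.
elim/nat_ind2: l => [||l h0 h1] //; first by rewrite /= on_site_scalar.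
have E m t' : fusion_rec t' q l.+2
  = t' l.+1 *m fusion_rec t' q l.+1 - q l *: fusion_rec t' q l :> 'M_m by [].
by rewrite !E h0 h1 -on_siteM -!scaleNr -on_siteZ -on_siteD.
Qed.

Lemma fusion_rec_horner n (X : 'M[C]_n.+1) (al : nat -> C) (be : C) q l :
  be != 0 -> exists2 p : {poly C}, size p = l.+1
    & fusion_rec (fun k => al k *: 1%:M + be *: X) q l = horner_mx X p.
Proof.
move=> hb; pose f k := al k *: 1 + be *: 'X : {poly C}.
have sf k : size (f k) = 2%N.
  have sX : size (be *: 'X : {poly C}) = 2%N by rewrite size_scale ?size_polyX.
  rewrite /f addrC size_polyDl sX //.
  by apply: leq_ltn_trans (size_scale_leq _ _) _; rewrite size_poly1.
have hf k : al k *: 1%:M + be *: X = horner_mx X (f k).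
  by rewrite /f rmorphD /= !linearZ /= [horner_mx X 1]rmorph1 horner_mx_X idmxE.
elim/nat_ind2: l => [||l [p0 s0 h0] [p1 s1 h1]].
- by exists 1; rewrite ?size_poly1 ?rmorph1.
- by exists (f 0%N); rewrite ?sf //=.
exists (f l.+1 * p1 - q l *: p0).
  have nf : f l.+1 != 0 by rewrite -size_poly_gt0 sf.
  have n1 : p1 != 0 by rewrite -size_poly_gt0 s1.
  have s2 : size (f l.+1 * p1) = l.+3 by rewrite size_mul // sf s1.
  rewrite size_polyDl s2 // size_polyN.
  by apply: leq_ltn_trans (size_scale_leq _ _) _; rewrite s0.
have -> : horner_mx X (f l.+1 * p1 - q l *: p0)
    = horner_mx X (f l.+1) *m horner_mx X p1 - q l *: horner_mx X p0.
  by rewrite rmorphB rmorphM /= linearZ.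
rewrite -h0 -h1 -hf.
by [].
Qed.

(** Level l is a polynomial in X of exact degree l, whatever the al and q are, so up to reversing
    the rows the matrix is an invertible triangular one times the Krylov matrix. *)
Lemma fusion_basis e (X : 'M[C]_e.+1) (s : 'rV[C]_e.+1) (al : nat -> C) (be : C) q :
  be != 0 -> krylov s X \in unitmx ->
  (\matrix_(h < e.+1, j < e.+1)
     (s *m fusion_rec (fun k => al k *: 1%:M + be *: X) q (e - h)) 0 j) \in unitmx.
Proof.
move=> hb hs.
pose t k := al k *: 1%:M + be *: X.
have [p hp] : exists p : 'I_e.+1 -> {poly C}, forall l : 'I_e.+1,
    size (p l) = l.+1 /\ fusion_rec t q l = horner_mx X (p l).
  apply: (@fin_all_exists 'I_e.+1 (fun=> {poly C}) (fun l p =>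
    size p = l.+1 /\ fusion_rec t q l = horner_mx X p)) => l.
  by have [p ? ?] := @fusion_rec_horner _ X al be q l hb; exists p.
pose B := \matrix_(h < e.+1, k < e.+1) (p h)`_k.
have uB : B \in unitmx.
  apply: trig_unitmx => [i j hij | i]; rewrite mxE.
    by rewrite nth_default // (hp i).1.
  have := (hp i).1; move=> hsz; rewrite -[i : nat]/(i.+1.-1) -hsz.
  by rewrite -/(lead_coef _) lead_coef_eq0 -size_poly_gt0 hsz.
have BK (h : 'I_e.+1) : row h (B *m krylov s X) = s *m fusion_rec t q h.
  have [hsz ->] := hp h; have hX : horner_mx X (p h) = \sum_(k < e.+1) (p h)`_k *: X ^+ k.
    rewrite -[in LHS](coefK (p h)) poly_def hsz raddf_sum /=.
    rewrite (big_ord_widen e.+1 (fun k => horner_mx X ((p h)`_k *: 'X^k))) //.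
    rewrite big_mkcond /=; apply: eq_bigr => k _.
    rewrite linearZ /= rmorphXn /= horner_mx_X ltnS.
    by case: leqP => // hk; rewrite nth_default ?scale0r // hsz.
  rewrite hX mulmx_sumr row_mul mulmx_sum_row; apply: eq_bigr => k _.
  rewrite -scalemxAr !mxE; congr (_ *: _).
  by apply/rowP => j; rewrite mxE [LHS]mxE.
have -> : \matrix_(h < e.+1, j < e.+1) (s *m fusion_rec t q (e - h)) 0 j
  = perm_mx (perm (@rev_ord_inj e.+1)) *m (B *m krylov s X).
  apply/row_matrixP => h; rewrite -row_permE.
  transitivity (row (rev_ord h) (B *m krylov s X)).
    by rewrite BK /= subSS; apply/rowP => j; rewrite mxE [LHS]mxE.
  by apply/rowP => j; rewrite mxE [RHS]mxE [RHS]mxE permE.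
by rewrite !unitmx_mul unitmx_perm uB.
Qed.

End FusionRecursion.

(** * The chain with far separated inhomogeneities *)

Section Rescaling.

Variables (C : numClosedFieldType) (eta : C) (eta0 : eta != 0).
Variables (N : nat) (e : 'I_N -> nat) (K : 'M[C]_2).

Local Notation endH := (endH C e).
Local Notation scal := (fun c : C => c%:M : endH).

Lemma twisted_lax_scale (rho c b : 'I_N -> C) i j :
  twisted_lax e K (fun n => rho n * c n) (fun n => rho n * b n) i j
  = (\prod_n rho n) *: twisted_lax e K c b i j.
Proof.
have H (s : seq 'I_N) i' j' :
  (\prod_(n <- s) site_lax e (rev_ord n) (rho (rev_ord n) * c (rev_ord n))
      (rho (rev_ord n) * b (rev_ord n))) i' j'
  = (\prod_(n <- s) rho (rev_ord n))
    *: (\prod_(n <- s) site_lax e (rev_ord n) (c (rev_ord n)) (b (rev_ord n))) i' j'.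
  elim: s i' j' => [|n s IHs] i' j'; first by rewrite !big_nil scale1r.
  rewrite !big_cons -!mulmxE [LHS]mxE [X in _ *: X]mxE scaler_sumr.
  apply: eq_bigr => k _; rewrite IHs -!mulmxE -scalemxAr.
  have -> : site_lax e (rev_ord n) (rho (rev_ord n) * c (rev_ord n))
      (rho (rev_ord n) * b (rev_ord n)) i' k
    = rho (rev_ord n) *: site_lax e (rev_ord n) (c (rev_ord n)) (b (rev_ord n)) i' k.
    rewrite /site_lax [LHS]mxE [X in _ *: X]mxE -on_siteZ; congr on_site.
    by rewrite !lax_mxE scalerDr !scalerA mulrA.
  by rewrite -scalemxAl scalerA mulrC.
rewrite /twisted_lax -!mulmxE [LHS]mxE [X in _ *: X]mxE scaler_sumr.
apply: eq_bigr => k _; rewrite H -!mulmxE -scalemxAr; congr (_ *: _).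
by rewrite [RHS](reindex_inj rev_ord_inj).
Qed.

Definition twisted_site (n : 'I_N) (y : C) : 'M[C]_((e n).+1) :=
  (y * \tr K) *: 1%:M
  + eta *: ((K 0 0 - K 1 1) *: spin_z C (e n) + K 0 1 *: spin_plus C (e n)
            + K 1 0 *: spin_minus C (e n)).

(** Where b = 0 the Lax operator is a scalar times the auxiliary identity; only the one-site
    transfer matrix of site n survives. *)
Lemma twisted_lax_single (n : 'I_N) (y : C) (c : 'I_N -> C) :
  \tr (twisted_lax e K (fun m => if m == n then y else c m)
                       (fun m => if m == n then eta else 0))
  = on_site (d := site_dim e) (n := n)
      ((\prod_(m | m != n) c m) *: twisted_site n y).
Proof.
pose L m := site_lax e m (if m == n then y else c m) (if m == n then eta else 0).
have H (s : seq 'I_N) i j : uniq s ->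
    (\prod_(m <- s) L (rev_ord m)) i j
    = (\prod_(m <- s | rev_ord m != n) c (rev_ord m))
      *: (if rev_ord n \in s then L n i j else (i == j)%:R%:M).
  elim: s i j => [|m s IHs] i j /=.
    by rewrite !big_nil scale1r mxE; case: (i == j); rewrite ?raddf0.
  move=> /andP[hm us]; rewrite !big_cons -!mulmxE [LHS]mxE inE.
  rewrite -[rev_ord n == m](inj_eq rev_ord_inj) rev_ordK eq_sym.
  case: (eqVneq (rev_ord m) n) => [mn | mn] /=.
    have ns : rev_ord n \notin s by rewrite -mn rev_ordK.
    under eq_bigr => k _ do rewrite IHs // (negbTE ns) -mulmxE -scalemxAr mul_mx_scalar.
    rewrite (bigD1 j) //= eqxx scale1r mn [X in _ + X]big1 ?addr0 // => k hk.
    by rewrite (negbTE hk) scale0r scaler0.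
  under eq_bigr => k _ do rewrite IHs // -mulmxE -scalemxAr.
  rewrite (bigD1 i) //= [X in _ + X]big1 ?addr0 => [|k hk].
    rewrite /L (negbTE mn) /site_lax [X in X *m _]mxE lax_mxE eqxx mulr1 scale0r addr0.
    by rewrite scalemx1 on_site_scalar mul_scalar_mx scalerA mulrC.
  rewrite /L (negbTE mn) /site_lax [X in X *m _]mxE lax_mxE eq_sym (negbTE hk).
  rewrite mulr0 !scale0r addr0 -(scale0r (0 : 'M[C]_((e (rev_ord m)).+1))).
  by rewrite [on_site _]on_siteZ scale0r mul0mx scaler0.
rewrite on_siteZ.
have E i : (map_mx scal K * \prod_(m < N) L (rev_ord m)) i i
   = (\prod_(m | m != n) c m) *: (K i 0 *: L n 0 i + K i 1 *: L n 1 i).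
  rewrite -mulmxE [LHS]mxE sum_two ![map_mx scal K _ _]mxE.
  rewrite !H ?index_enum_uniq // mem_index_enum.
  rewrite -!mulmxE !mul_scalar_mx !scalerA scalerDr !scalerA.
  have <- : \prod_(m < N | rev_ord m != n) c (rev_ord m) = \prod_(m | m != n) c m.
    by rewrite [RHS](reindex_inj rev_ord_inj).
  by rewrite ![K _ _ * _]mulrC.
rewrite [\tr (twisted_lax _ _ _ _)]/mxtrace sum_two !E -scalerDr; congr (_ *: _).
rewrite /L eqxx /site_lax !mxE.
rewrite -!(on_siteZ (d := site_dim e)) -!(on_siteD (d := site_dim e)); congr on_site.
rewrite /twisted_site /mxtrace sum_two; apply/matrixP => p q; rewrite !mxE /=.
by ring.
Qed.

Lemma fused_transfer_rec xi lambda l :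
  fused_transfer eta e xi K l lambda
  = fusion_rec (fun k => transfer eta e xi K (lambda + k%:R * eta))
      (fun k => \det K * a_fun eta e xi (lambda + k.+1%:R * eta)
                * d_fun eta e xi (lambda + k%:R * eta)) l.
Proof.
elim/nat_ind2: l => [||l h0 h1]; first exact: fused_transfer0.
  by rewrite fused_transfer1 //= mul0r addr0.
by rewrite fused_transfer_fusion // h0 h1.
Qed.

(* With xi_m = m / u, multiplying the Lax operator of site m by [rho n u m]
   makes it polynomial in u at spectral parameters near xi_n. *)
Definition rho (n : 'I_N) (u : C) (m : 'I_N) : C := if m == n then 1 else u.

Definition far (u : C) (n : 'I_N) : C := n%:R / u.

(** The value of lambda - xi_n + eta/2 at lambda = xi_n^{(2s_n)} + l eta. *)
Definition offset (n : 'I_N) (l : nat) : C := (l%:R - half_spin C (e n)) * eta.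

(** For nonzero u this is u^(N-1) times the transfer matrix at xi_n^{(2s_n)} + l eta, the difference
    n - m being u (xi_n - xi_m). *)
Definition far_transfer (n : 'I_N) (u : C) (l : nat) : 'M[C]_(hdim e) :=
  \tr (twisted_lax e K (fun m => n%:R - m%:R + rho n u m * offset n l)
                       (fun m => rho n u m * eta)).

Definition far_qdet (n : 'I_N) (u : C) (l : nat) : C :=
  \det K
  * \prod_(m < N) (n%:R - m%:R + rho n u m * (offset n l.+1 + half_spin C (e m) * eta))
  * \prod_(m < N) (n%:R - m%:R + rho n u m * (offset n l - half_spin C (e m) * eta)).

Definition far_fused (n : 'I_N) (u : C) (l : nat) : 'M[C]_(hdim e) :=
  fusion_rec (far_transfer n u) (far_qdet n u) l.

Lemma far_rho (n m : 'I_N) (u z : C) : u != 0 ->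
  n%:R - m%:R + rho n u m * z = rho n u m * (far u n - far u m + z).
Proof.
move=> u0; rewrite /rho /far; case: (eqVneq m n) => [->|_]; first by field.
by field.
Qed.

Lemma far_fusedE n u l : u != 0 ->
  far_fused n u l = (\prod_m rho n u m) ^+ l
    *: fused_transfer eta e (far u) K l (xi_shift eta e (far u) n (e n)).
Proof.
move=> u0; rewrite fused_transfer_rec -fusion_rec_scale.
apply: eq_fusion_rec => k.
  rewrite /far_transfer /transfer monodromyE /mxtrace !sum_two scalerDr.
  rewrite -!(twisted_lax_scale (rho n u)).
  have -> : (fun m : 'I_N => n%:R - m%:R + rho n u m * offset n k)
    = (fun m => rho n u m * (xi_shift eta e (far u) n (e n) + k%:R * eta
                             - far u m + eta / 2%:R)).
    apply/boolp.funext => m; rewrite far_rho // /xi_shift /offset /half_spin.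
    by congr (_ * _); field.
  by [].
rewrite /far_qdet /a_fun /d_fun expr2.
rewrite (eq_bigr (fun m => rho n u m * (xi_shift eta e (far u) n (e n)
   + k.+1%:R * eta - xi_shift eta e (far u) m (e m)))) => [|m _]; last first.
  rewrite far_rho // /xi_shift /offset /half_spin -natr1.
  by congr (_ * _); field.
rewrite [X in _ * _ * X](eq_bigr (fun m => rho n u m * (xi_shift eta e (far u) n (e n)
   + k%:R * eta - xi_shift eta e (far u) m 0))) => [|m _]; last first.
  rewrite far_rho // /xi_shift /offset /half_spin.
  by congr (_ * _); field.
rewrite !big_split /=; ring.
Qed.

Lemma far_fused_poly n l : mx_poly (@poly_fun C) (fun u => far_fused n u l).
Proof.
have hP := poly_fun_closed C; have [_ hcst hadd hmul] := hP.
have hrho m : poly_fun (fun u => rho n u m).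
  by rewrite /rho; case: (m == n); [exact: hcst | exact: poly_fun_id].
have haff m a b : poly_fun (fun u => a + rho n u m * b).
  by apply: (hadd (fun=> a)); [exact: hcst | apply: (hmul _ _ _ _) => //; exact: hcst].
apply: (fusion_rec_poly _ hP) => k.
  rewrite /far_transfer; apply: (twisted_trace_poly (e := e) K
    (c := fun u m => n%:R - m%:R + rho n u m * offset n k)
    (b := fun u m => rho n u m * eta) hP) => m; first exact: haff.
  by apply: hmul => //; exact: hcst.
apply: (hmul _ _ _ _); first apply: (hmul _ _ _ _); first exact: hcst.
  by apply: (poly_closed_prod hP).
by apply: (poly_closed_prod hP).
Qed.

Lemma far_fused0 n : exists al : nat -> C, exists2 be : C, be != 0 &
  exists q, forall l, far_fused n 0 l = on_site (d := site_dim e) (n := n)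
    (fusion_rec (fun k => al k *: 1%:M + be *:
       ((K 0 0 - K 1 1) *: spin_z C (e n) + K 0 1 *: spin_plus C (e n)
            + K 1 0 *: spin_minus C (e n))) q l).
Proof.
(* The scalar contributed by the other sites at u = 0, nonzero since the sites carry distinct
   integers. *)
pose ga : C := \prod_(m < N | m != n) (n%:R - m%:R).
exists (fun k => ga * (offset n k * \tr K)), (ga * eta).
  rewrite mulf_neq0 //; apply/prodf_neq0 => m hm.
  by rewrite subr_eq0 eqr_nat eq_sym.
exists (far_qdet n 0) => l; rewrite /far_fused -fusion_rec_on_site.
apply: eq_fusion_rec => // k.
rewrite /far_transfer.
have -> : (fun m : 'I_N => n%:R - m%:R + rho n 0 m * offset n k)
    = (fun m => if m == n then offset n k else n%:R - m%:R).
  apply/boolp.funext => m; rewrite /rho; case: (eqVneq m n) => [->|_].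
    by rewrite subrr add0r mul1r.
  by rewrite mul0r addr0.
have -> : (fun m => rho n 0 m * eta) = (fun m => if m == n then eta else 0).
  by apply/boolp.funext => m; rewrite /rho; case: eqVneq; rewrite ?mul1r ?mul0r.
rewrite twisted_lax_single; congr on_site.
by rewrite /twisted_site -/ga scalerDr !scalerA.
Qed.

End Rescaling.

Lemma row_on_site (C : numClosedFieldType) (p : nat) (d : 'I_p -> nat)
    (s : forall n, 'rV[C]_(d n)) (A : forall n, 'M[C]_(d n)) (j : 'I_(tdim d)) :
  ((\row_i \prod_n s n 0 (mindex i n)) *m \prod_n on_site (A n)) 0 j
  = \prod_n (s n *m A n) 0 (mindex j n).
Proof.
rewrite mxE (reindex (enum_rank : tidx d -> 'I_(tdim d))); last first.
  exact: onW_bij (enum_rank_bij _).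
transitivity (\sum_(f : tidx d) \prod_n (s n 0 (f n) * A n (f n) (mindex j n))).
  apply: eq_bigr => f _; rewrite mxE on_siteE -big_split /=.
  by apply: eq_bigr => n _; rewrite mindexK.
rewrite (prod_sum_dffun (fun n x => s n 0 x * A n x (mindex j n))).
by apply: eq_bigr => n _; rewrite mxE.
Qed.

Lemma mulmx_prod_scale (C : numClosedFieldType) (d : nat) (I : Type) (s : seq I)
    (S : 'rV[C]_d) (c : I -> C) (F : I -> 'M[C]_d) :
  S *m \prod_(n <- s) (c n *: F n)
  = (\prod_(n <- s) c n) *: (S *m \prod_(n <- s) F n).
Proof.
rewrite scalemxAr; congr (_ *m _); elim: s => [|n s IHs].
  by rewrite !big_nil scale1r.
by rewrite !big_cons IHs -!mulmxE -scalemxAl -scalemxAr scalerA.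
Qed.

Lemma on_site_prod_unitmx (C : numClosedFieldType) (p : nat) (d : 'I_p -> nat)
    (B : forall n, 'M[C]_(d n)) :
  (forall n, B n \in unitmx) -> \prod_n on_site (B n) \in unitmx.
Proof.
move=> hB; elim/big_rec: _ => [|n X _ hX]; first exact: unitmx1.
rewrite -mulmxE unitmx_mul hX andbT.
suff /mulmx1_unit[] : on_site (B n) *m on_site (invmx (B n)) = 1%:M by [].
by rewrite -on_siteM mulmxV // on_site_scalar.
Qed.

Section Genericity.

Variables (C : numClosedFieldType) (eta : C) (eta0 : eta != 0).
Variables (N : nat) (e : 'I_N -> nat) (K : 'M[C]_2) (k2 : C) (k20 : k2 != 0).

Local Notation pt := (xi_shift eta e).

(** The covectors without their scalar normalisation, as rows: these are polynomial in xi and S. *)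
Definition sov_numerator (xi : 'I_N -> C) (S : 'rV[C]_(hdim e)) : 'M[C]_(hdim e) :=
  \matrix_(i, j) (S *m \prod_(n < N)
    fused_transfer eta e xi K (e n - mindex i n) (pt xi n (e n))) 0 j.

Definition sov_denominator (xi : 'I_N -> C) : C :=
  \prod_(n < N) \prod_(k < e n) d_fun eta e xi (pt xi n (e n - k)).

Lemma sov_basis_det xi S :
  \det (sov_numerator xi S) * sov_denominator xi != 0 ->
  sov_basis eta xi K k2 S.
Proof.
rewrite mulf_eq0 negb_or => /andP[hnum hden].
pose B : 'M[C]_(hdim e) :=
  \matrix_(i < tdim (site_dim e)) sov_covector eta xi K k2 S (mindex i).
pose r (i : 'I_(tdim (site_dim e))) := \prod_(n < N) (k2 ^- (e n - mindex i n) /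
   \prod_(k < e n - mindex i n) d_fun eta e xi (pt xi n (e n - k))).
have r0 i : r i != 0.
  apply/prodf_neq0 => n _; rewrite mulf_neq0 ?invr_eq0 ?expf_neq0 //.
  apply/prodf_neq0 => k _.
  (* The denominator of each covector is a partial product of [sov_denominator]. *)
  have hk : (k < e n)%N by apply: leq_trans (ltn_ord k) (leq_subr _ _).
  move/prodf_neq0/(_ n isT)/prodf_neq0/(_ (Ordinal hk) isT): hden.
  by [].
have hB : B = diag_mx (\row_i r i) *m sov_numerator xi S.
  apply/row_matrixP => i; rewrite rowK; apply/rowP => j.
  rewrite [RHS]mxE mul_diag_mx [RHS]mxE [(\row_ _ _) _ _]mxE.
  rewrite [sov_numerator _ _ _ _]mxE /sov_covector.
  by rewrite mulmx_prod_scale mxE.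
have uB : B \in unitmx.
  rewrite hB unitmx_mul; apply/andP; split; last by rewrite unitmxE unitfE.
  rewrite unitmxE det_diag unitfE; apply/prodf_neq0 => i _; rewrite mxE; exact: r0.
rewrite /sov_basis basisEdim; apply/andP; split; last first.
  by rewrite size_image dimvf /dim /= mul1n.
apply/subvP => v _; rewrite -[v]mulmx1 -(mulVmx uB) mulmxA mulmx_sum_row.
apply: memv_suml => i _; apply: memvZ; apply: memv_span.
by rewrite rowK; apply: image_f.
Qed.

Hypothesis Kscal : ~~ is_scalar_mx K.

Lemma exists_local_rows : exists s : forall n, 'rV[C]_((e n).+1), forall n,
  krylov (s n) ((K 0 0 - K 1 1) *: spin_z C (e n) + K 0 1 *: spin_plus C (e n)
            + K 1 0 *: spin_minus C (e n)) \in unitmx.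
Proof.
apply: (@fin_all_exists 'I_N (fun n => 'rV[C]_((e n).+1)) (fun n s => krylov s
  ((K 0 0 - K 1 1) *: spin_z C (e n) + K 0 1 *: spin_plus C (e n)
            + K 1 0 *: spin_minus C (e n)) \in unitmx)) => n.
apply: sl2_cyclic; apply: contraNT Kscal; rewrite !negb_or !negbK.
move=> /and3P[h1 /eqP h2 /eqP h3]; apply/is_scalar_mxP; exists (K 0 0).
apply/matrixP => i j; rewrite mxE.
case: (ord2_cases i) => ->; case: (ord2_cases j) => -> //=.
by apply/eqP; rewrite eq_sym -subr_eq0.
Qed.

Lemma sov_numerator_generic : exists xi, exists S,
  \det (sov_numerator xi S) * sov_denominator xi != 0.
Proof.
have [s hs] := exists_local_rows.
pose S : 'rV[C]_(hdim e) := \row_i \prod_n s n 0 (mindex i n).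
pose num u : 'M[C]_(hdim e) := \matrix_(i, j) (S *m \prod_(n < N)
  far_fused eta e K n u (e n - mindex i n)) 0 j.
(* The denominators cleared of 1/u; at u = 0 the factors are n - m for m different from n and -
   (2s_n - k) eta for m = n, all nonzero. *)
pose den u : C := \prod_(n < N) \prod_(k < e n) \prod_(m < N)
  (n%:R - m%:R + rho n u m *
    ((half_spin C (e n) - (e n - k)%:R - half_spin C (e m)) * eta)).
have hP := poly_fun_closed C; have [hext hcst hadd hmul] := hP.
have [f hf] : poly_fun (fun u => \det (num u) * den u).
  apply: (hmul _ _ _ _).
    apply: (mx_poly_det hP) => i j.
    have := mx_poly_mul hP (mx_poly_cst hP S) (mx_poly_prod hP (index_enum _)
      (fun n => far_fused_poly eta K n (e n - mindex i n))) 0 j.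
    by apply: hext => u; rewrite [RHS]mxE.
  apply: (poly_closed_prod hP) => n; apply: (poly_closed_prod hP) => k.
  apply: (poly_closed_prod hP) => m.
  apply: (hadd (fun=> _)); first exact: hcst.
  apply: (hmul _ _ _ _); last exact: hcst.
  by rewrite /rho; case: (m == n); [exact: hcst | exact: poly_fun_id].
have num0 : num 0 \in unitmx.
  have [A hA] : exists A : forall n, nat -> 'M[C]_((e n).+1), forall n,
      (forall l, far_fused eta e K n 0 l = on_site (d := site_dim e) (n := n) (A n l))
      /\ \matrix_(h < (e n).+1, j < (e n).+1) (s n *m A n (e n - h)%N) 0 j \in unitmx.
    apply: (@fin_all_exists 'I_N (fun n => nat -> 'M[C]_((e n).+1)) (fun n A =>
      (forall l, far_fused eta e K n 0 l = on_site (d := site_dim e) (n := n) (A l))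
      /\ \matrix_(h < (e n).+1, j < (e n).+1) (s n *m A (e n - h)%N) 0 j \in unitmx)) => n.
    have [al [be hbe [q hq]]] := far_fused0 eta0 e K n.
    by eexists; split; [exact: hq | apply: fusion_basis].
  pose B n : 'M[C]_(site_dim e n) :=
    \matrix_(h < (e n).+1, j < (e n).+1) (s n *m A n (e n - h)%N) 0 j.
  (* As S is a product covector and each factor acts on one site, the matrix of covectors is the
     tensor product of the local ones. *)
  have -> : num 0 = \prod_n on_site (B n).
    apply/matrixP => i j; rewrite mxE on_siteE.
    rewrite (eq_bigr (fun n =>
      on_site (d := site_dim e) (n := n) (A n (e n - mindex i n)%N))).
      rewrite (row_on_site (d := site_dim e) s (fun n => A n (e n - mindex i n)%N)).
      by apply: eq_bigr => n _; rewrite [RHS]mxE.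
    by move=> n _; rewrite (hA n).1.
  by apply: on_site_prod_unitmx => n; exact: (hA n).2.
have f0 : f.[0] != 0.
  rewrite -hf mulf_neq0 //; first by rewrite -unitfE -unitmxE.
  apply/prodf_neq0 => n _; apply/prodf_neq0 => k _; apply/prodf_neq0 => m _.
  rewrite /rho; case: (eqVneq m n) => [->|hmn].
    rewrite subrr add0r mul1r mulf_neq0 // addrAC subrr add0r oppr_eq0.
    by rewrite pnatr_eq0 subn_eq0 -ltnNge.
  by rewrite mul0r addr0 subr_eq0 eqr_nat eq_sym.
(* The factor 'X forces u to be nonzero, as needed to return to xi_n = n / u. *)
have [u] : exists u, (f * 'X).[u] != 0.
  apply: nonzero_poly_value; rewrite mulf_neq0 ?polyX_eq0 //.
  by apply: contraNneq f0 => ->; rewrite horner0.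
rewrite hornerM hornerX mulf_eq0 negb_or -hf mulf_eq0 negb_or.
move=> /andP[/andP[hn hd] u0]; exists (far u), S; rewrite mulf_neq0 //.
  apply: contraNneq hn => h0.
  have -> : num u = diag_mx (\row_i \prod_(n < N)
      (\prod_m rho n u m) ^+ (e n - mindex i n)) *m sov_numerator (far u) S.
    apply/matrixP => i j; rewrite mul_diag_mx [LHS]mxE [RHS]mxE.
    rewrite [(\row_ _ _) _ _]mxE [sov_numerator _ _ _ _]mxE.
    rewrite (eq_bigr _ (fun n _ => far_fusedE eta0 e K n (e n - mindex i n) u0)).
    by rewrite mulmx_prod_scale mxE.
  by rewrite det_mulmx h0 mulr0.
apply/prodf_neq0 => n _; apply/prodf_neq0 => k _; apply/prodf_neq0 => m _.
move/prodf_neq0/(_ n isT)/prodf_neq0/(_ k isT)/prodf_neq0/(_ m isT): hd.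
rewrite far_rho // mulf_eq0 negb_or => /andP[_].
apply: contraNneq => h; apply/eqP; rewrite -[RHS]h /xi_shift.
by ring.
Qed.

End Genericity.

(** * Polynomial dependence on the inhomogeneities and on S *)

Section Multivariate.

Variables (C : numClosedFieldType) (p : nat).

Definition mpoly_fun (f : ('I_p -> C) -> C) : Prop :=
  exists Q : {mpoly C[p]}, forall v, f v = Q.@[v].

Lemma mpoly_fun_closed : poly_closed mpoly_fun.
Proof.
split=> [f g fg [Q hQ] | c | f g [Q hQ] [Q' hQ'] | f g [Q hQ] [Q' hQ']].
- by exists Q => v; rewrite -fg.
- by exists c%:MP => v; rewrite mevalC.
- by exists (Q + Q') => v; rewrite mevalD hQ hQ'.
- by exists (Q * Q') => v; rewrite mevalM hQ hQ'.
Qed.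

Lemma mpoly_fun_var i : mpoly_fun (fun v => v i).
Proof. by exists 'X_i => v; rewrite mevalXU. Qed.

End Multivariate.

Section PolynomialDependence.

Variables (C : numClosedFieldType) (eta : C) (eta0 : eta != 0).
Variables (N : nat) (e : 'I_N -> nat) (K : 'M[C]_2).
Variables (X : Type) (P : (X -> C) -> Prop) (hP : poly_closed P).
Variable xi : X -> 'I_N -> C.
Hypothesis xiP : forall n, P (fun x => xi x n).

Let Pcst c : P (fun=> c). Proof. by case: hP. Qed.
Let Padd f g : P f -> P g -> P (fun x => f x + g x).
Proof. by case: hP => _ _ h _; exact: h. Qed.
Let Pmul f g : P f -> P g -> P (fun x => f x * g x).
Proof. by case: hP => _ _ _ h; exact: h. Qed.
Let Psub f g : P f -> P g -> P (fun x => f x - g x).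
Proof. by move=> hf hg; apply: Padd => //; exact: (poly_closed_opp hP). Qed.

Lemma xi_shift_poly n k : P (fun x => xi_shift eta e (xi x) n k).
Proof. by apply: Padd (Pcst _); apply: Psub (Pcst _). Qed.

Lemma d_fun_poly lambda : P lambda -> P (fun x => d_fun eta e (xi x) (lambda x)).
Proof.
move=> h; apply: (poly_closed_prod hP) => n.
exact: Psub h (xi_shift_poly _ _).
Qed.

Lemma a_fun_poly lambda : P lambda -> P (fun x => a_fun eta e (xi x) (lambda x)).
Proof.
move=> h; apply: (poly_closed_prod hP) => n.
exact: Psub h (xi_shift_poly _ _).
Qed.

Lemma transfer_poly lambda : P lambda ->
  mx_poly P (fun x => transfer eta e (xi x) K (lambda x)).
Proof.
move=> h; have -> : (fun x => transfer eta e (xi x) K (lambda x))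
  = (fun x => \tr (twisted_lax e K (fun n => lambda x - xi x n + eta / 2%:R)
                                  (fun=> eta))).
  by apply/boolp.funext => x; rewrite /transfer monodromyE.
apply: (twisted_trace_poly K (c := fun x n => lambda x - xi x n + eta / 2%:R)
  (b := fun _ _ => eta) hP) => n; last exact: Pcst.
exact: Padd (Psub h (xiP n)) (Pcst _).
Qed.

Lemma fused_transfer_poly lambda l : P lambda ->
  mx_poly P (fun x => fused_transfer eta e (xi x) K l (lambda x)).
Proof.
move=> h; have -> : (fun x => fused_transfer eta e (xi x) K l (lambda x))
  = (fun x => fusion_rec (fun k => transfer eta e (xi x) K (lambda x + k%:R * eta))
      (fun k => \det K * a_fun eta e (xi x) (lambda x + k.+1%:R * eta)
                * d_fun eta e (xi x) (lambda x + k%:R * eta)) l).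
  by apply/boolp.funext => x; exact: fused_transfer_rec.
have hl k : P (fun x => lambda x + k%:R * eta) by exact: Padd h (Pcst _).
apply: (fusion_rec_poly _ hP) => k; first exact: transfer_poly (hl k).
exact: Pmul (Pmul (Pcst _) (a_fun_poly (hl _))) (d_fun_poly (hl _)).
Qed.

Lemma sov_det_poly (S : X -> 'rV[C]_(hdim e)) : mx_poly P S ->
  P (fun x => \det (sov_numerator eta K (xi x) (S x))
              * sov_denominator eta e (xi x)).
Proof.
move=> hS; apply: Pmul; last first.
  apply: (poly_closed_prod hP) => n; apply: (poly_closed_prod hP) => k.
  exact: d_fun_poly (xi_shift_poly _ _).
apply: (mx_poly_det hP) => i j.
have := mx_poly_mul hP hS (mx_poly_prod hP (index_enum _)
  (fun n => fused_transfer_poly (e n - mindex i n) (xi_shift_poly n (e n)))) 0 j.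
by case: hP => hext _ _ _; apply: hext => x; rewrite [RHS]mxE.
Qed.

End PolynomialDependence.

Theorem proposition4p2 (R : realType) (eta : R[i]) (heta : eta != 0)
    (N : nat) (hN : (0 < N)%N) (e : 'I_N -> nat) (he : forall n, (0 < e n)%N)
    (K : 'M[R[i]]_2) (hK : K \in unitmx) (hKs : ~~ is_scalar_mx K)
    (k1 k2 : R[i]) (hk : char_poly K = ('X - k1%:P) * ('X - k2%:P)) :
  (exists2 Q : {mpoly R[i][N + hdim e]}, Q != 0 &
    forall (xi : 'I_N -> R[i]) (S : 'rV[R[i]]_(hdim e)),
      distinct_mod_eta eta xi ->
      Q.@[row_mx (\row_n xi n) S 0] != 0 ->
      sov_basis eta xi K k2 S)
  /\
  (forall (xi : 'I_N -> R[i]) (S : 'rV[R[i]]_(hdim e)),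
    distinct_mod_eta eta xi ->
    sov_basis eta xi K k2 S ->
    forall (n : 'I_N) (h : tidx (site_dim e)),
      let x := xi_shift eta e xi n (h n) in
      sov_covector eta xi K k2 S h *m transfer eta e xi K x =
        (k1 * a_fun eta e xi x) *:
          sov_covector_ext eta xi K k2 S
            (fun m => (h m)%:Z + (m == n)%:Z)
        + (k2 * d_fun eta e xi x) *:
          sov_covector_ext eta xi K k2 S
            (fun m => (h m)%:Z - (m == n)%:Z)).
Proof.
have detK : \det K = k1 * k2.
  (* The characteristic polynomial at 0 gives det K, the constant in the quantum determinant. *)
  have := char_poly_det K; rewrite hk -horner_coef0 hornerM !hornerXsubC.
  by rewrite expr2 !sub0r !mulrNN !mul1r => <-.
have k20 : k2 != 0.
  by move: hK; rewrite unitmxE unitfE detK mulf_eq0 negb_or => /andP[].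
split=> [|xi S _ hb n h x]; last first.
  apply: (sov_covector_transfer heta S detK k20) => m k hk0.
  exact: sov_basis_d_fun hb hk0.
(* The first N variables of Q are the inhomogeneities, the others the coordinates of S. *)
pose xi_of (v : 'I_(N + hdim e) -> R[i]) n := v (lshift (hdim e) n).
pose S_of (v : 'I_(N + hdim e) -> R[i]) := \row_j v (rshift N j).
have xiE xi (S : 'rV[R[i]]_(hdim e)) : xi_of (row_mx (\row_n xi n) S 0) = xi.
  by apply/boolp.funext => n; rewrite /xi_of row_mxEl mxE.
have SE xi (S : 'rV[R[i]]_(hdim e)) : S_of (row_mx (\row_n xi n) S 0) = S.
  by apply/rowP => j; rewrite mxE row_mxEr.
have [Q hQ] : mpoly_fun (fun v => \det (sov_numerator eta K (xi_of v) (S_of v))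
    * sov_denominator eta e (xi_of v)).
  apply: sov_det_poly => //; first exact: mpoly_fun_closed.
    by move=> n; exact: mpoly_fun_var.
  move=> i j; have [hext _ _ _] := mpoly_fun_closed R[i] (N + hdim e).
  by apply: hext (mpoly_fun_var _ (rshift N j)) => v; rewrite mxE.
exists Q.
  (* One pair at which the determinant does not vanish shows that Q is not the zero polynomial. *)
  have [xi [S h]] := sov_numerator_generic heta e hKs.
  by apply: contraNneq h => Q0; have := hQ (row_mx (\row_n xi n) S 0);
     rewrite xiE SE Q0 meval0 => ->.
move=> xi S _; rewrite -hQ xiE SE; exact: sov_basis_det.
Qed.
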